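(* Let $\mathcal V$ be a multivector field on $X$, let $S$ be an isolated invariant set, and let $P=(P_1,P_2)$ and $Q=(Q_1,Q_2)$ be two index pairs for $S$. Then $H(P_1,P_2)\cong H(Q_1,Q_2)$. (Consequently the homology Conley index $\operatorname{Con}(S):=H(P_1,P_2)$ is well defined.)
   Context: $X$ is a finite $T_0$ topological space. For $A\subset X$, $\operatorname{cl}A$ is its closure and $\operatorname{mo}A:=\operatorname{cl}A\setminus A$. $A$ is locally closed if it is the intersection of an open and a closed subset of $X$. $H$ denotes relative singular homology. A multivector is a nonempty locally closed subset of $X$; a multivector field $\mathcal V$ on $X$ is a partition of $X$ into multivectors. For $x\in X$, $[x]$ denotes the element of $\mathcal V$ containing $x$. A multivector $V$ is critical if $H(\operatorname{cl}V,\operatorname{mo}V)\neq0$, regular otherwise. Put $\Pi_{\mathcal V}(x):=[x]\cup\operatorname{cl}\{x\}$ and $\Pi_{\mathcal V}(A):=\bigcup_{x\in A}\Pi_{\mathcal V}(x)$. A $\mathbb Z$-interval is $\mathbb Z\cap I$ for a real interval $I$. A solution in $A\subset X$ is a map $\varphi:D\to A$ on a $\mathbb Z$-interval $D$ with $\varphi(i+1)\in\Pi_{\mathcal V}(\varphi(i))$ whenever $i,i+1\in D$; it is full if $D=\mathbb Z$, and a path if $D$ is bounded, its endpoints being $\varphi(\min D)$ and $\varphi(\max D)$. A full solution $\varphi$ is essential if for every $t\in\mathbb Z$ with $[\varphi(t)]$ regular, the set $\{s\in\mathbb Z:\varphi(s)\notin[\varphi(t)]\}$ is unbounded below and unbounded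 above. $\operatorname{Inv}A$ is the set of $x\in A$ such that there is an essential full solution $\varphi$ with image in $A$ and $\varphi(0)=x$; $A$ is invariant if $\operatorname{Inv}A=A$. A closed set $N$ isolates an invariant set $S\subset N$ if (a) every path in $N$ with both endpoints in $S$ has image contained in $S$, and (b) $\Pi_{\mathcal V}(S)\subset N$. An invariant set is an isolated invariant set if some closed set isolates it. An index pair for an isolated invariant set $S$ is a pair $(P_1,P_2)$ of closed subsets of $X$ with $P_2\subset P_1$ such that (IP1) if $x\in P_2$ and $y\in\Pi_{\mathcal V}(x)\cap P_1$ then $y\in P_2$; (IP2) if $x\in P_1$ and $\Pi_{\mathcal V}(x)\setminus P_1\neq\emptyset$ then $x\in P_2$; (IP3) $S=\operatorname{Inv}(P_1\setminus P_2)$. *)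

(* Defs.v *)
From Stdlib Require Import Reals ZArith List Arith Classical ClassicalEpsilon.
Import ListNotations.

Record FiniteT0Space := {
  pt :> Type;
  is_open : (pt -> Prop) -> Prop;
  open_ext : forall U W : pt -> Prop,
      (forall x, U x <-> W x) -> is_open U -> is_open W;
  open_full : is_open (fun _ => True);
  open_inter : forall U W, is_open U -> is_open W -> is_open (fun x => U x /\ W x);
  open_union : forall F : (pt -> Prop) -> Prop,
      (forall U, F U -> is_open U) -> is_open (fun x => exists U, F U /\ U x);
  finite_pts : exists l : list pt, forall x, In x l;
  T0_ax : forall x y : pt, x <> y -> exists U, is_open U /\ ~ (U x <-> U y)
}.

Section Topo.
Variable X : FiniteT0Space.

Definition is_closed (C : X -> Prop) : Prop := is_open X (fun x => ~ C x).

Definition cl (A : X -> Prop) : X -> Prop :=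
  fun x => forall C, is_closed C -> (forall y, A y -> C y) -> C x.

Definition mo (A : X -> Prop) : X -> Prop := fun x => cl A x /\ ~ A x.

Definition locally_closed (A : X -> Prop) : Prop :=
  exists U C, is_open X U /\ is_closed C /\ forall x, A x <-> (U x /\ C x).

Definition inDelta (n : nat) (t : nat -> R) : Prop :=
  (forall i, (i <= n)%nat -> (0 <= t i)%R) /\
  (forall i, (n < i)%nat -> t i = 0%R) /\
  sum_f_R0 t n = 1%R.

(* a (candidate) n-simplex: only its values on Delta^n matter *)
Definition simplex := (nat -> R) -> X.

Definition sing_continuous (n : nat) (s : simplex) : Prop :=
  forall U, is_open X U -> forall t, inDelta n t -> U (s t) ->
    exists eps, (0 < eps)%R /\
      forall u, inDelta n u ->
        (forall i, (i <= n)%nat -> (Rabs (u i - t i) < eps)%R) -> U (s u).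

Definition agree (n : nat) (s s' : simplex) : Prop :=
  forall t, inDelta n t -> s t = s' t.

Definition chain := list (Z * simplex).

Definition coeff (n : nat) (c : chain) (s : simplex) : Z :=
  fold_right (fun p acc =>
    ((if excluded_middle_informative (agree n (snd p) s) then fst p else 0)
     + acc)%Z) 0%Z c.

Definition eqc (n : nat) (c c' : chain) : Prop :=
  forall s, coeff n c s = coeff n c' s.

Definition negc (c : chain) : chain := map (fun p => ((- fst p)%Z, snd p)) c.

Definition face (i : nat) (t : nat -> R) : nat -> R :=
  fun j => if (j <? i)%nat then t j else if (j =? i)%nat then 0%R else t (j - 1)%nat.

Definition bdry (n : nat) (c : chain) : chain :=
  match n with
  | O => []
  | S _ => flat_map (fun p =>
             map (fun i => (((Z.pow (-1) (Z.of_nat i)) * fst p)%Z,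
                             fun t => snd p (face i t)))
                 (seq 0 (S n))) c
  end.

Definition supp (n : nat) (A : X -> Prop) (c : chain) : Prop :=
  forall s, coeff n c s <> 0%Z ->
    sing_continuous n s /\ forall t, inDelta n t -> A (s t).

Definition rcycle (n : nat) (A B : X -> Prop) (c : chain) : Prop :=
  supp n A c /\ supp (n - 1) B (bdry n c).

Definition rbound (n : nat) (A B : X -> Prop) (c : chain) : Prop :=
  exists d e, supp (S n) A d /\ supp n B e /\ eqc n c (bdry (S n) d ++ e).

Definition homeq (n : nat) (A B : X -> Prop) (c c' : chain) : Prop :=
  rbound n A B (c ++ negc c').

Definition H_trivial (n : nat) (A B : X -> Prop) : Prop :=
  forall c, rcycle n A B c -> rbound n A B c.

(* H_n(A,B) and H_n(A',B') are isomorphic abelian groups: a group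
   isomorphism of the quotients, given on representatives *)
Definition H_iso (n : nat) (A B A' B' : X -> Prop) : Prop :=
  exists f : chain -> chain,
    (forall c, rcycle n A B c -> rcycle n A' B' (f c)) /\
    (forall c c', rcycle n A B c -> rcycle n A B c' ->
        homeq n A B c c' -> homeq n A' B' (f c) (f c')) /\
    (forall c c', rcycle n A B c -> rcycle n A B c' ->
        homeq n A' B' (f (c ++ c')) (f c ++ f c')) /\
    (forall c c', rcycle n A B c -> rcycle n A B c' ->
        homeq n A' B' (f c) (f c') -> homeq n A B c c') /\
    (forall c', rcycle n A' B' c' ->
        exists c, rcycle n A B c /\ homeq n A' B' (f c) c').

Definition H_isomorphic (A B A' B' : X -> Prop) : Prop :=
  forall n, H_iso n A B A' B'.

Definition multivector (A : X -> Prop) : Prop :=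
  (exists x, A x) /\ locally_closed A.

Definition multivector_field (V : (X -> Prop) -> Prop) : Prop :=
  (forall W, V W -> multivector W) /\
  (forall x, exists W, V W /\ W x) /\
  (forall W W' x, V W -> V W' -> W x -> W' x -> forall y, W y <-> W' y).

Definition vclass (V : (X -> Prop) -> Prop) (x : X) : X -> Prop :=
  fun y => exists W, V W /\ W x /\ W y.

Definition critical (W : X -> Prop) : Prop :=
  ~ (forall n, H_trivial n (cl W) (mo W)).
Definition regular (W : X -> Prop) : Prop :=
  forall n, H_trivial n (cl W) (mo W).

Definition Pi (V : (X -> Prop) -> Prop) (x : X) : X -> Prop :=
  fun y => vclass V x y \/ cl (fun z => z = x) y.

Definition PiSet (V : (X -> Prop) -> Prop) (A : X -> Prop) : X -> Prop :=
  fun y => exists x, A x /\ Pi V x y.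

Definition full_solution (V : (X -> Prop) -> Prop) (A : X -> Prop) (phi : Z -> X) : Prop :=
  (forall i, A (phi i)) /\ (forall i, Pi V (phi i) (phi (i + 1)%Z)).

Definition essential (V : (X -> Prop) -> Prop) (phi : Z -> X) : Prop :=
  forall t, regular (vclass V (phi t)) ->
    (forall m, exists s, (s <= m)%Z /\ ~ vclass V (phi t) (phi s)) /\
    (forall m, exists s, (m <= s)%Z /\ ~ vclass V (phi t) (phi s)).

Definition Inv (V : (X -> Prop) -> Prop) (A : X -> Prop) : X -> Prop :=
  fun x => exists phi, full_solution V A phi /\ essential V phi /\ phi 0%Z = x.

Definition invariant (V : (X -> Prop) -> Prop) (A : X -> Prop) : Prop :=
  forall x, Inv V A x <-> A x.

Definition path_in (V : (X -> Prop) -> Prop) (A : X -> Prop)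
    (a b : Z) (phi : Z -> X) : Prop :=
  (a <= b)%Z /\
  (forall i, (a <= i <= b)%Z -> A (phi i)) /\
  (forall i, (a <= i < b)%Z -> Pi V (phi i) (phi (i + 1)%Z)).

Definition isolates (V : (X -> Prop) -> Prop) (N S : X -> Prop) : Prop :=
  is_closed N /\ (forall x, S x -> N x) /\
  (forall a b phi, path_in V N a b phi -> S (phi a) -> S (phi b) ->
     forall i, (a <= i <= b)%Z -> S (phi i)) /\
  (forall y, PiSet V S y -> N y).

Definition isolated_invariant (V : (X -> Prop) -> Prop) (S : X -> Prop) : Prop :=
  invariant V S /\ exists N, isolates V N S.

Definition index_pair (V : (X -> Prop) -> Prop) (S P1 P2 : X -> Prop) : Prop :=
  is_closed P1 /\ is_closed P2 /\ (forall x, P2 x -> P1 x) /\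
  (forall x y, P2 x -> Pi V x y -> P1 y -> P2 y) /\
  (forall x, P1 x -> (exists y, Pi V x y /\ ~ P1 y) -> P2 x) /\
  (forall x, S x <-> Inv V (fun z => P1 z /\ ~ P2 z) x).

End Topo.

(* Main.v *)
(** Two index pairs are compared through the invariant set itself: for an index pair (P1, P2) of S
    we show H(P1, P2) = H(cl S, mo S).  The set A = P1 \ P2 is a union of multivectors with
    Inv A = S.  Let A' be the part of A that can be reached from S inside A, and put
    M = P2 \/ A' and K = P2 \/ (A' \ S).  Both are closed, and neither P1 \ M nor K \ P2 carries an
    essential solution, so both can be exhausted by regular multivectors, one at a time, and
    H(P1, M) = 0 = H(K, P2).  Finally M \ K = S, so excision identifies H(M, K) with H(cl S, mo S).

    The topological input is excision for two closed subsets of a finite space, i.e. the inclusion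
    S(A) + S(B) -> S(A \/ B) of singular complexes is a homology isomorphism.  Removing a minimal
    point x of Y = A \/ B gives a cover of Y by the open sets Y \ {x} and {y | x <= y}; small
    simplices (barycentric subdivision) reduce the claim to these two sets and their intersection,
    where it holds by induction, respectively because {y | x <= y} is a cone with apex x. *)
Require Import Defs.
From Stdlib Require Import Reals ZArith List Arith Classical ClassicalEpsilon.
From Stdlib Require Import Lia Lra FunctionalExtensionality PropExtensionality.
Import ListNotations.

(** * Formal sums and the singular boundary *)

Local Open Scope Z_scope.

(** The pair [(cl S, mo S)] depends on [S] alone, so two index pairs never have to be related by a
    map or by intermediate index pairs. The price is excision for closed sets, which fails in
    general spaces and here rests on finiteness. Small simplices handle open covers only, and the
    sums S(A) + S(B) are not singular complexes of subspaces. Relative homology is therefore treated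
    for arbitrary families of simplices stable under affine reparametrisation. For families only
    vanishing is asserted ([acy]): the exact sequence of a triple and excision become rules for
    [acy], proved by moving chains, and isomorphisms enter only on the return to pairs of subspaces.
    Excision is also what makes regularity the right condition: when a multivector [W] is added to a
    closed set [F'] containing [mo W] and disjoint from [W], the relative homology that appears is
    that of [(cl W, mo W)]. *)

Definition ev {B : Type} (g : B -> Z) (c : list (Z * B)) : Z :=
  fold_right (fun p acc => fst p * g (snd p) + acc) 0 c.

Definition scale {B : Type} (a : Z) (c : list (Z * B)) : list (Z * B) :=
  map (fun p => (a * fst p, snd p)) c.

Definition mapb {B B' : Type} (f : B -> B') (c : list (Z * B)) : list (Z * B') :=
  map (fun p => (fst p, f (snd p))) c.

Definition lin {B B' : Type} (f : B -> list (Z * B')) (c : list (Z * B)) : list (Z * B') :=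
  flat_map (fun p => scale (fst p) (f (snd p))) c.

Lemma ev_app {B : Type} (g : B -> Z) (c d : list (Z * B)) :
  ev g (c ++ d) = ev g c + ev g d.
Proof. induction c as [|p c IH]; simpl; [reflexivity|]. rewrite IH. lia. Qed.

Lemma ev_scale {B : Type} (g : B -> Z) (a : Z) (c : list (Z * B)) :
  ev g (scale a c) = a * ev g c.
Proof. induction c as [|p c IH]; unfold scale, ev in *; simpl; [lia|]. rewrite IH. lia. Qed.

Lemma ev_mapb {B B' : Type} (g : B' -> Z) (f : B -> B') (c : list (Z * B)) :
  ev g (mapb f c) = ev (fun b => g (f b)) c.
Proof. induction c as [|p c IH]; unfold mapb, ev in *; simpl; [reflexivity|]. rewrite IH. reflexivity. Qed.

Lemma ev_lin {B B' : Type} (g : B' -> Z) (f : B -> list (Z * B')) (c : list (Z * B)) :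
  ev g (lin f c) = ev (fun b => ev g (f b)) c.
Proof.
  induction c as [|p c IH]; [reflexivity|].
  change (lin f (p :: c)) with (scale (fst p) (f (snd p)) ++ lin f c).
  rewrite ev_app, ev_scale, IH. reflexivity.
Qed.

Lemma ev_ext_in {B : Type} (g h : B -> Z) (c : list (Z * B)) :
  (forall p, In p c -> g (snd p) = h (snd p)) -> ev g c = ev h c.
Proof.
  induction c as [|p c IH]; intros H; [reflexivity|]. simpl.
  rewrite (H p (or_introl eq_refl)), IH; [reflexivity|].
  intros q Hq. apply H. right; exact Hq.
Qed.

Lemma ev_ext {B : Type} (g h : B -> Z) (c : list (Z * B)) :
  (forall b, g b = h b) -> ev g c = ev h c.
Proof. intros H. apply ev_ext_in. auto. Qed.

Lemma ev_add {B : Type} (g h : B -> Z) (c : list (Z * B)) :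
  ev (fun b => g b + h b) c = ev g c + ev h c.
Proof. induction c as [|p c IH]; simpl; [reflexivity|]. rewrite IH. lia. Qed.

Lemma ev_sub {B : Type} (g h : B -> Z) (c : list (Z * B)) :
  ev (fun b => g b - h b) c = ev g c - ev h c.
Proof. induction c as [|p c IH]; simpl; [reflexivity|]. rewrite IH. lia. Qed.

Lemma ev_zero {B : Type} (c : list (Z * B)) : ev (fun _ => 0) c = 0.
Proof. induction c as [|p c IH]; simpl; [reflexivity|]. rewrite IH. lia. Qed.

Lemma in_mapb {B B' : Type} (f : B -> B') (c : list (Z * B)) q :
  In q (mapb f c) -> exists p, In p c /\ snd q = f (snd p).
Proof.
  unfold mapb. rewrite in_map_iff. intros [p [<- Hp]]. exists p. auto.
Qed.

Lemma in_lin {B B' : Type} (f : B -> list (Z * B')) (c : list (Z * B)) q :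
  In q (lin f c) -> exists p r, In p c /\ In r (f (snd p)) /\ snd q = snd r.
Proof.
  unfold lin. rewrite in_flat_map. intros [p [Hp Hq]].
  unfold scale in Hq. apply in_map_iff in Hq. destruct Hq as [r [<- Hr]].
  exists p, r. auto.
Qed.

(** An alternating sum of n terms; nested subtraction keeps powers of -1 out of the inductions. *)
Fixpoint asum (n : nat) (h : nat -> Z) : Z :=
  match n with
  | O => 0
  | S m => h O - asum m (fun i => h (S i))
  end.

Lemma asum_ext (n : nat) : forall h k : nat -> Z,
  (forall i, (i < n)%nat -> h i = k i) -> asum n h = asum n k.
Proof.
  induction n as [|n IH]; intros h k H; [reflexivity|]. simpl.
  rewrite (H O) by lia. f_equal. apply IH. intros i Hi. apply H. lia.
Qed.

Lemma asum_sub (n : nat) : forall h k : nat -> Z,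
  asum n (fun i => h i - k i) = asum n h - asum n k.
Proof.
  induction n as [|n IH]; intros h k; [reflexivity|]. simpl. rewrite IH. lia.
Qed.

(** The terms at [(S i, j)] and [(j, i)] with [j <= i] carry opposite signs and cancel, as in every
    proof that a double boundary vanishes. The induction strips row 0 and column 0, which cancel
    each other. *)
Lemma asum_asum (n : nat) : forall h : nat -> nat -> Z,
  (forall i j, (j <= i)%nat -> (i < n)%nat -> h (S i) j = h j i) ->
  asum (S n) (fun i => asum n (h i)) = 0.
Proof.
  induction n as [|n IH]; intros h H; [reflexivity|].
  change (asum (S (S n)) (fun i => asum (S n) (h i)))
    with (asum (S n) (h O) - asum (S n) (fun i => asum (S n) (h (S i)))).
  change (fun i => asum (S n) (h (S i)))
    with (fun i => h (S i) O - asum n (fun j => h (S i) (S j))).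
  rewrite asum_sub, (IH (fun i j => h (S i) (S j))).
  - rewrite (asum_ext (S n) (fun i => h (S i) O) (h O)); [lia|].
    intros i Hi. apply H; lia.
  - intros i j Hj Hi. apply H; lia.
Qed.

Lemma ev_alternating {B : Type} (a : Z) (f : nat -> B) (g : B -> Z) (n : nat) : forall k,
  ev g (map (fun i => ((-1) ^ Z.of_nat i * a, f i)) (seq k n))
  = (-1) ^ Z.of_nat k * a * asum n (fun i => g (f (k + i)%nat)).
Proof.
  induction n as [|n IH]; intros k; simpl; [lia|].
  rewrite IH. rewrite Nat.add_0_r.
  replace (Z.of_nat (S k)) with (Z.succ (Z.of_nat k)) by lia.
  rewrite Z.pow_succ_r by lia.
  rewrite (asum_ext n (fun i => g (f (S k + i)%nat)) (fun i => g (f (k + S i)%nat))).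
  - lia.
  - intros i _. do 2 f_equal. lia.
Qed.

Section SingularChains.
Context {X : FiniteT0Space}.

Notation simplex := (simplex X).
Notation chain := (chain X).

Definition resp (n : nat) (g : simplex -> Z) : Prop :=
  forall s s', agree X n s s' -> g s = g s'.

(* Equality of chains, tested on integer functionals instead of coefficients (see [eqc_eqv]): every
   linear identity then only has to be checked on single simplices. *)
Definition eqv (n : nat) (c c' : chain) : Prop :=
  forall g, resp n g -> ev g c = ev g c'.

(** The coboundary of a functional, adjoint to [bdry] under [ev]. *)
Definition dg (n : nat) (g : simplex -> Z) : simplex -> Z :=
  fun s => asum (S (S n)) (fun i => g (fun t => s (face i t))).

Lemma ev_bdry (n : nat) (g : simplex -> Z) (c : chain) :
  ev g (bdry X (S n) c) = ev (dg n g) c.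
Proof.
  induction c as [|p c IH]; [reflexivity|].
  change (bdry X (S n) (p :: c)) with
    (map (fun i => ((-1) ^ Z.of_nat i * fst p, fun t => snd p (face i t))) (seq 0 (S (S n)))
     ++ bdry X (S n) c).
  rewrite ev_app, IH, ev_alternating.
  change (ev (dg n g) (p :: c)) with (fst p * dg n g (snd p) + ev (dg n g) c).
  unfold dg at 2. change (Z.of_nat 0) with 0. rewrite Z.pow_0_r. cbn [Nat.add]. lia.
Qed.

Lemma ev_negc (g : simplex -> Z) (c : chain) : ev g (negc X c) = - ev g c.
Proof. induction c as [|p c IH]; unfold negc, ev in *; simpl; [reflexivity|]. rewrite IH. lia. Qed.

Lemma coeff_ev (n : nat) (c : chain) (s : simplex) :
  coeff X n c s
  = ev (fun s' => if excluded_middle_informative (agree X n s' s) then 1 else 0) c.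
Proof.
  induction c as [|p c IH]; simpl; [reflexivity|]. rewrite IH.
  destruct (excluded_middle_informative _); lia.
Qed.

Lemma agree_sym n (s s' : simplex) : agree X n s s' -> agree X n s' s.
Proof. intros H t Ht. symmetry. auto. Qed.

Lemma agree_trans n (s s' s'' : simplex) :
  agree X n s s' -> agree X n s' s'' -> agree X n s s''.
Proof. intros H H' t Ht. rewrite H by assumption. auto. Qed.

Lemma resp_indicator n (P : simplex -> Prop) :
  (forall s s', agree X n s s' -> P s -> P s') ->
  resp n (fun s => if excluded_middle_informative (P s) then 1 else 0).
Proof.
  intros HP s s' H. pose proof (agree_sym _ _ _ H).
  destruct (excluded_middle_informative (P s)), (excluded_middle_informative (P s'));
    try reflexivity; exfalso; eauto.
Qed.

Lemma resp_mul n (g h : simplex -> Z) : resp n g -> resp n h -> resp n (fun s => g s * h s).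
Proof. intros Hg Hh s s' H. rewrite (Hg s s' H), (Hh s s' H). reflexivity. Qed.

Definition select (P : simplex -> Prop) (c : chain) : chain :=
  filter (fun p => if excluded_middle_informative (P (snd p)) then true else false) c.

Lemma ev_select (P : simplex -> Prop) (g : simplex -> Z) (c : chain) :
  ev g (select P c)
  = ev (fun s => g s * (if excluded_middle_informative (P s) then 1 else 0)) c.
Proof.
  induction c as [|p c IH]; [reflexivity|]. unfold select in *. simpl.
  destruct (excluded_middle_informative (P (snd p))); simpl; rewrite IH; lia.
Qed.

Lemma ev_split (P : simplex -> Prop) (g : simplex -> Z) (c : chain) :
  ev g c = ev g (select P c) + ev g (select (fun s => ~ P s) c).
Proof.
  rewrite !ev_select, <- ev_add. apply ev_ext. intros s.
  destruct (excluded_middle_informative (P s)), (excluded_middle_informative (~ P s));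
    try lia; tauto.
Qed.

Lemma select_length (P : simplex -> Prop) (c : chain) :
  (length (select P c) <= length c)%nat.
Proof. apply filter_length_le. Qed.

(** Terms agreeing with the head [s] contribute [g s] times the coefficient of [s], and removing
    them changes no other coefficient. What remains is not a tail of the list, so the induction runs
    over a bound for its length. *)
Lemma ev_coeff_zero (n : nat) (g : simplex -> Z) (Hg : resp n g) : forall c : chain,
  (forall s, g s <> 0 -> coeff X n c s = 0) -> ev g c = 0.
Proof.
  intros c. remember (length c) as N eqn:HN.
  assert (HN' : (length c <= N)%nat) by lia. clear HN. revert c HN'.
  induction N as [|N IH]; intros c HN H.
  - destruct c; [reflexivity|simpl in HN; lia].
  - destruct c as [|[a s] c]; [reflexivity|].
    rewrite (ev_split (fun s' => agree X n s' s)).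
    rewrite (IH (select (fun s' => ~ agree X n s' s) ((a, s) :: c))).
    + replace (ev g (select (fun s' => agree X n s' s) ((a, s) :: c)))
        with (g s * coeff X n ((a, s) :: c) s).
      * destruct (Z.eq_dec (g s) 0) as [E|E]; [rewrite E|rewrite (H s E)]; lia.
      * rewrite coeff_ev, ev_select.
        generalize ((a, s) :: c). intros d. induction d as [|q d IHd]; simpl; [lia|].
        rewrite <- IHd. destruct (excluded_middle_informative (agree X n (snd q) s)) as [e|e].
        -- rewrite (Hg _ _ e). ring.
        -- ring.
    + assert (E : select (fun s' => ~ agree X n s' s) ((a, s) :: c)
                  = select (fun s' => ~ agree X n s' s) c).
      { unfold select. simpl. destruct (excluded_middle_informative (~ agree X n s s)) as [e|e];
          [exfalso; apply e; intros t _; reflexivity|reflexivity]. }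
      rewrite E. eapply Nat.le_trans; [apply select_length|]. simpl in HN. lia.
    + intros s' Hs'. rewrite coeff_ev, ev_select.
      destruct (classic (agree X n s' s)) as [e|e].
      * transitivity (ev (fun _ : simplex => 0) ((a, s) :: c)); [|apply ev_zero]. apply ev_ext. intros u. cbv beta.
        destruct (excluded_middle_informative (agree X n u s')) as [e1|e1]; [|lia].
        destruct (excluded_middle_informative (~ agree X n u s)) as [e2|e2]; [|lia].
        exfalso. apply e2. eapply agree_trans; eassumption.
      * transitivity (coeff X n ((a, s) :: c) s'); [|apply H; exact Hs']. rewrite coeff_ev. apply ev_ext. intros u. cbv beta.
        destruct (excluded_middle_informative (agree X n u s')) as [e1|e1]; [|lia].
        destruct (excluded_middle_informative (~ agree X n u s)) as [e2|e2]; [lia|].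
        exfalso. apply e2. intros e3. apply e. eapply agree_trans; [apply agree_sym|]; eassumption.
Qed.

Lemma eqc_eqv n (c c' : chain) : eqc X n c c' <-> eqv n c c'.
Proof.
  split.
  - intros H g Hg.
    assert (E : ev g (c ++ negc X c') = 0).
    { apply (ev_coeff_zero n g Hg). intros s _. specialize (H s).
      rewrite !coeff_ev in *. rewrite ev_app, ev_negc. lia. }
    rewrite ev_app, ev_negc in E. lia.
  - intros H s. rewrite !coeff_ev. apply H.
    apply (resp_indicator n (fun s' => agree X n s' s)).
    intros u u' e e'. eapply agree_trans; [apply agree_sym|]; eassumption.
Qed.

Lemma face_comm (i j : nat) (t : nat -> R) : (j <= i)%nat ->
  face (S i) (face j t) = face j (face i t).
Proof.
  intros H. apply functional_extensionality. intros k. unfold face.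
  repeat match goal with
  | |- context [(?a <? ?b)%nat] => destruct (Nat.ltb_spec a b)
  | |- context [(?a =? ?b)%nat] => destruct (Nat.eqb_spec a b)
  end; try lia; try reflexivity; f_equal; lia.
Qed.

Lemma ev_bdry_bdry n (g : simplex -> Z) (c : chain) : ev (dg (S n) (dg n g)) c = 0.
Proof.
  transitivity (ev (fun _ : simplex => 0) c); [|apply ev_zero]. apply ev_ext. intros s. unfold dg.
  apply (asum_asum (S (S n)) (fun i j => g (fun t => s (face i (face j t))))).
  intros i j Hj Hi. f_equal. apply functional_extensionality. intros t.
  rewrite face_comm by assumption. reflexivity.
Qed.

End SingularChains.

(** * Affine simplices *)

Local Open Scope R_scope.

Notation point := (nat -> R).

Definition ptail (t : point) : point := fun i => t (S i).

Fixpoint psum (n : nat) (t : point) : R :=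
  match n with
  | O => 0
  | S m => t O + psum m (ptail t)
  end.

(** The point with barycentric coordinates [t] over the vertices [l]. An affine simplex is
    represented by its vertex list; the recursion consumes vertices and coordinates in step. *)
Fixpoint aff (l : list point) (t : point) : point :=
  match l with
  | [] => fun _ => 0
  | v :: l' => fun j => t O * v j + aff l' (ptail t) j
  end.

Definition unit_pt (i : nat) : point := fun j => if (j =? i)%nat then 1 else 0.

Definition iota (n : nat) : list point := map unit_pt (seq 0 (S n)).

Fixpoint del {T : Type} (i : nat) (l : list T) : list T :=
  match l, i with
  | [], _ => []
  | _ :: l', O => l'
  | a :: l', S i' => a :: del i' l'
  end.

Fixpoint lsum (l : list point) : point :=
  match l with
  | [] => fun _ => 0
  | v :: l' => fun j => v j + lsum l' j
  end.

Definition bary (l : list point) : point := fun j => / INR (length l) * lsum l j.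

Lemma psum_sum n : forall t, sum_f_R0 t n = psum (S n) t.
Proof.
  induction n as [|n IH]; intros t; [simpl; lra|].
  rewrite decomp_sum by lia. simpl pred. rewrite (IH (fun i => t (S i))). reflexivity.
Qed.

Lemma psum_ext n : forall t u, (forall i, (i < n)%nat -> t i = u i) -> psum n t = psum n u.
Proof.
  induction n as [|n IH]; intros t u H; [reflexivity|]. simpl.
  rewrite (H O) by lia. f_equal. apply IH. intros i Hi. apply H. lia.
Qed.

Lemma psum_zero n : psum n (fun _ => 0) = 0.
Proof. induction n as [|n IH]; simpl; [reflexivity|]. unfold ptail. rewrite IH. lra. Qed.

Lemma psum_lin n : forall (a : R) (v t : point),
  psum n (fun j => a * v j + t j) = a * psum n v + psum n t.
Proof.
  induction n as [|n IH]; intros a v t; simpl; [lra|].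
  change (ptail (fun j => a * v j + t j)) with (fun j => a * ptail v j + ptail t j).
  rewrite IH. lra.
Qed.

Lemma psum_diff n : forall (e : R) (t u : point),
  (forall i, (i < n)%nat -> Rabs (t i - u i) <= e) -> Rabs (psum n t - psum n u) <= INR n * e.
Proof.
  induction n as [|n IH]; intros e t u H.
  - simpl. rewrite Rminus_diag, Rabs_R0. lra.
  - rewrite S_INR. simpl psum.
    replace (t O + psum n (ptail t) - (u O + psum n (ptail u)))
      with ((t O - u O) + (psum n (ptail t) - psum n (ptail u))) by lra.
    eapply Rle_trans; [apply Rabs_triang|].
    assert (Rabs (psum n (ptail t) - psum n (ptail u)) <= INR n * e).
    { apply IH. intros i Hi. apply H. lia. }
    assert (Rabs (t O - u O) <= e) by (apply H; lia). lra.
Qed.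

Lemma psum_ge n : forall t i, (forall j, (j < n)%nat -> 0 <= t j) -> (i < n)%nat ->
  0 <= t i <= psum n t.
Proof.
  assert (P : forall n t, (forall j, (j < n)%nat -> 0 <= t j) -> 0 <= psum n t).
  { clear n. intros n. induction n as [|n IH]; intros t H; simpl; [lra|].
    assert (0 <= t O) by (apply H; lia).
    assert (0 <= psum n (ptail t)) by (apply IH; intros j Hj; apply H; lia). lra. }
  induction n as [|n IH]; intros t i H Hi; [lia|]. simpl.
  assert (0 <= t O) by (apply H; lia).
  assert (H' : forall j, (j < n)%nat -> 0 <= ptail t j) by (intros j Hj; apply H; lia).
  specialize (P n _ H'). destruct i as [|i]; [lra|].
  specialize (IH (ptail t) i H'). unfold ptail in IH at 1 2. lapply IH; [lra|lia].
Qed.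

Lemma psum_scale n : forall a t, psum n (fun j => a * t j) = a * psum n t.
Proof.
  intros a t. transitivity (psum n (fun j => a * t j + 0)).
  - apply psum_ext. intros; lra.
  - rewrite psum_lin, psum_zero. lra.
Qed.

Lemma ptail_face (i : nat) (t : point) : ptail (face (S i) t) = face i (ptail t).
Proof.
  apply functional_extensionality. intros k. unfold ptail, face.
  repeat match goal with
  | |- context [(?a <? ?b)%nat] => destruct (Nat.ltb_spec a b)
  | |- context [(?a =? ?b)%nat] => destruct (Nat.eqb_spec a b)
  end; try lia; try reflexivity; f_equal; lia.
Qed.

Lemma ptail_face0 (t : point) : ptail (face 0 t) = t.
Proof. apply functional_extensionality. intros k. unfold ptail, face. simpl. f_equal. lia. Qed.

Lemma face_scale (a : R) (i : nat) (t : point) :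
  face i (fun j => a * t j) = fun j => a * face i t j.
Proof.
  apply functional_extensionality. intros k. unfold face.
  destruct (k <? i)%nat, (k =? i)%nat; lra.
Qed.

Lemma psum_face n : forall i t, (i <= n)%nat -> psum (S n) (face i t) = psum n t.
Proof.
  induction n as [|n IH]; intros i t Hi.
  - assert (i = O) by lia. subst. simpl. unfold face. simpl. lra.
  - destruct i as [|i].
    + change (face 0 t O + psum (S n) (ptail (face 0 t)) = psum (S n) t).
      rewrite ptail_face0. unfold face. simpl. lra.
    + change (face (S i) t O + psum (S n) (ptail (face (S i) t)) = t O + psum n (ptail t)).
      rewrite ptail_face, IH by lia. reflexivity.
Qed.

Lemma face_inDelta n i t : (i <= S n)%nat -> inDelta n t -> inDelta (S n) (face i t).
Proof.
  intros Hi (H1 & H2 & H3). split; [|split].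
  - intros j Hj. unfold face. destruct (Nat.ltb_spec j i); [apply H1; lia|].
    destruct (Nat.eqb_spec j i); [lra|]. apply H1; lia.
  - intros j Hj. unfold face. destruct (Nat.ltb_spec j i); [apply H2; lia|].
    destruct (Nat.eqb_spec j i); [lra|]. apply H2; lia.
  - rewrite psum_sum in *. rewrite psum_face by lia. exact H3.
Qed.

Lemma inDelta_le1 n t i : inDelta n t -> 0 <= t i <= 1.
Proof.
  intros (H1 & H2 & H3). destruct (le_lt_dec i n) as [H|H].
  - rewrite <- H3, psum_sum. apply psum_ge; [intros j Hj; apply H1; lia|lia].
  - rewrite H2 by assumption. lra.
Qed.

Lemma unit_pt_inDelta n i : (i <= n)%nat -> inDelta n (unit_pt i).
Proof.
  intros Hi. split; [|split].
  - intros j _. unfold unit_pt. destruct (Nat.eqb_spec j i); lra.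
  - intros j Hj. unfold unit_pt. destruct (Nat.eqb_spec j i); [lia|lra].
  - rewrite psum_sum. assert (Hi' : (i < S n)%nat) by lia. clear Hi.
    revert i Hi'. induction (S n) as [|m IH]; intros i Hi; [lia|]. simpl.
    destruct i as [|i].
    + change (ptail (unit_pt 0)) with (fun _ : nat => 0). rewrite psum_zero.
      unfold unit_pt. simpl. lra.
    + change (ptail (unit_pt (S i))) with (unit_pt i). rewrite IH by lia.
      unfold unit_pt. simpl. lra.
Qed.

Lemma iota_length n : length (iota n) = S n.
Proof. unfold iota. rewrite length_map, length_seq. reflexivity. Qed.

Lemma iota_inDelta n : Forall (inDelta n) (iota n).
Proof.
  apply Forall_forall. intros v Hv. apply in_map_iff in Hv. destruct Hv as [i [<- Hi]].
  apply in_seq in Hi. apply unit_pt_inDelta. lia.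
Qed.

Lemma aff_face l : forall i t, (i < length l)%nat -> aff l (face i t) = aff (del i l) t.
Proof.
  induction l as [|v l IH]; intros i t Hi; simpl in Hi; [lia|].
  apply functional_extensionality. intros j. destruct i as [|i]; simpl.
  - rewrite ptail_face0. unfold face. simpl. lra.
  - rewrite ptail_face, IH by lia. reflexivity.
Qed.

Lemma aff_zero w : aff w (fun _ => 0) = fun _ => 0.
Proof.
  induction w as [|x w IH]; [reflexivity|]. apply functional_extensionality; intros j.
  simpl. change (ptail (fun _ : nat => 0)) with (fun _ : nat => 0). rewrite IH. lra.
Qed.

Lemma aff_comp w l : forall t, aff w (aff l t) = aff (map (aff w) l) t.
Proof.
  assert (Lin : forall w a v u, aff w (fun j => a * v j + u j)
                          = fun j => a * aff w v j + aff w u j).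
  { clear. induction w as [|x w IH]; intros a v u; apply functional_extensionality; intros j;
      simpl; [lra|].
    change (ptail (fun j => a * v j + u j)) with (fun j => a * ptail v j + ptail u j).
    rewrite IH. lra. }
  induction l as [|v l IH]; intros t; simpl; [apply aff_zero|]. rewrite Lin, IH. reflexivity.
Qed.

Lemma aff_iota n t : (forall i, (n < i)%nat -> t i = 0) -> aff (iota n) t = t.
Proof.
  intros H. apply functional_extensionality. intros j.
  assert (E : forall m k t, aff (map unit_pt (seq k m)) t j
     = if (k <=? j)%nat then (if (j <? k + m)%nat then t (j - k)%nat else 0) else 0).
  { clear. induction m as [|m IH]; intros k t; simpl.
    - destruct (Nat.leb_spec k j), (Nat.ltb_spec j (k + 0)); try lia; lra.
    - rewrite IH. unfold unit_pt, ptail.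
      destruct (Nat.eqb_spec j k), (Nat.leb_spec (S k) j), (Nat.ltb_spec j (S k + m)),
        (Nat.leb_spec k j), (Nat.ltb_spec j (k + S m)); try lia; try lra.
      + subst. replace (k - k)%nat with O by lia. lra.
      + replace (j - k)%nat with (S (j - S k)) by lia. lra. }
  unfold iota. rewrite E. destruct (Nat.leb_spec 0 j), (Nat.ltb_spec j (0 + S n)); try lia.
  - f_equal. lia.
  - rewrite H by lia. reflexivity.
Qed.

(** Every affine simplex is the affine image of the standard one; together with naturality this
    carries [sd] and [sdh] from [iota n] to arbitrary vertex lists. *)
Lemma map_aff_iota n w : length w = S n -> map (aff w) (iota n) = w.
Proof.
  intros H. unfold iota. rewrite <- H, map_map. clear H.
  induction w as [|v w IH]; [reflexivity|]. simpl. f_equal.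
  - apply functional_extensionality. intros j.
    change (ptail (unit_pt 0)) with (fun _ : nat => 0). rewrite aff_zero. unfold unit_pt. simpl. lra.
  - rewrite <- IH at 2. rewrite <- seq_shift, map_map. apply map_ext. intros i.
    apply functional_extensionality. intros j.
    change (ptail (unit_pt (S i))) with (unit_pt i). unfold unit_pt at 1. simpl. lra.
Qed.

Lemma aff_le (M : R) (j : nat) l : forall t,
  (forall i, (i < length l)%nat -> 0 <= t i) -> (forall v, In v l -> v j <= M) ->
  aff l t j <= psum (length l) t * M.
Proof.
  induction l as [|v l IH]; intros t Ht Hl; simpl; [lra|].
  assert (v j <= M) by (apply Hl; left; reflexivity).
  assert (0 <= t O) by (apply Ht; simpl; lia).
  assert (aff l (ptail t) j <= psum (length l) (ptail t) * M).
  { apply IH; [intros i Hi; apply Ht; simpl; lia|intros u Hu; apply Hl; right; exact Hu]. }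
  assert (t O * v j <= t O * M) by (apply Rmult_le_compat_l; assumption). lra.
Qed.

Lemma aff_ge (M : R) (j : nat) l : forall t,
  (forall i, (i < length l)%nat -> 0 <= t i) -> (forall v, In v l -> M <= v j) ->
  psum (length l) t * M <= aff l t j.
Proof.
  induction l as [|v l IH]; intros t Ht Hl; simpl; [lra|].
  assert (M <= v j) by (apply Hl; left; reflexivity).
  assert (0 <= t O) by (apply Ht; simpl; lia).
  assert (psum (length l) (ptail t) * M <= aff l (ptail t) j).
  { apply IH; [intros i Hi; apply Ht; simpl; lia|intros u Hu; apply Hl; right; exact Hu]. }
  assert (t O * M <= t O * v j) by (apply Rmult_le_compat_l; assumption). lra.
Qed.

Lemma aff_near (p e : R) (j : nat) l m t :
  length l = S m -> inDelta m t -> (forall v, In v l -> Rabs (v j - p) <= e) ->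
  Rabs (aff l t j - p) <= e.
Proof.
  intros Hl (H1 & _ & H3) H. rewrite psum_sum in H3.
  assert (H1' : forall i, (i < length l)%nat -> 0 <= t i) by (intros i Hi; apply H1; lia).
  assert (A := aff_le (p + e) j l t H1'). assert (B := aff_ge (p - e) j l t H1').
  rewrite Hl, H3 in *. apply Rabs_le. split.
  - lapply B; [lra|]. intros v Hv. specialize (H v Hv). unfold Rabs in H; destruct (Rcase_abs _) in H; lra.
  - lapply A; [lra|]. intros v Hv. specialize (H v Hv). unfold Rabs in H; destruct (Rcase_abs _) in H; lra.
Qed.

Lemma aff_inDelta n m l t :
  length l = S m -> inDelta m t -> Forall (inDelta n) l -> inDelta n (aff l t).
Proof.
  intros Hl (H1 & _ & H3) H. rewrite Forall_forall in H. rewrite psum_sum in H3.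
  assert (H1' : forall i, (i < length l)%nat -> 0 <= t i) by (intros i Hi; apply H1; lia).
  rewrite <- Hl in H3. clear H1 Hl m. split; [|split].
  - intros i Hi. replace 0 with (psum (length l) t * 0) by lra. apply aff_ge; [assumption|].
    intros v Hv. apply (H v Hv). exact Hi.
  - intros i Hi. apply Rle_antisym.
    + replace 0 with (psum (length l) t * 0) by lra. apply aff_le; [assumption|].
      intros v Hv. right. apply (H v Hv). exact Hi.
    + replace 0 with (psum (length l) t * 0) by lra. apply aff_ge; [assumption|].
      intros v Hv. right. symmetry. apply (H v Hv). exact Hi.
  - rewrite psum_sum, <- H3. clear H1' H3. revert t.
    induction l as [|v l IH]; intros t; [apply psum_zero|].
    change (aff (v :: l) t) with (fun j => t O * v j + aff l (ptail t) j).
    rewrite psum_lin, IH by (intros u Hu; apply H; right; exact Hu).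
    rewrite <- psum_sum. destruct (H v (or_introl eq_refl)) as (_ & _ & ->). simpl. lra.
Qed.

Lemma aff_cont l : forall (e : R) (t u : point), 0 <= e ->
  (forall v, In v l -> forall j, Rabs (v j) <= 1) ->
  (forall i, (i < length l)%nat -> Rabs (u i - t i) <= e) ->
  forall j, Rabs (aff l u j - aff l t j) <= INR (length l) * e.
Proof.
  induction l as [|v l IH]; intros e t u He Hv H j.
  - simpl. rewrite Rminus_diag, Rabs_R0. lra.
  - cbn [length]. rewrite S_INR. simpl aff.
    replace (u O * v j + aff l (ptail u) j - (t O * v j + aff l (ptail t) j))
      with ((u O - t O) * v j + (aff l (ptail u) j - aff l (ptail t) j)) by lra.
    eapply Rle_trans; [apply Rabs_triang|].
    assert (Rabs (aff l (ptail u) j - aff l (ptail t) j) <= INR (length l) * e).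
    { apply IH; [assumption|intros w Hw; apply Hv; right; exact Hw|].
      intros i Hi. apply H. simpl. lia. }
    assert (Rabs (u O - t O) <= e) by (apply H; simpl; lia).
    assert (Rabs (v j) <= 1) by (apply Hv; left; reflexivity).
    rewrite Rabs_mult.
    assert (Rabs (u O - t O) * Rabs (v j) <= e * 1)
      by (apply Rmult_le_compat; auto using Rabs_pos).
    lra.
Qed.

Lemma del_length {T : Type} (l : list T) : forall i, (i < length l)%nat ->
  S (length (del i l)) = length l.
Proof.
  induction l as [|a l IH]; intros i Hi; simpl in Hi; [lia|]. destruct i as [|i]; [reflexivity|].
  simpl. rewrite IH by lia. reflexivity.
Qed.

Lemma del_Forall {T : Type} (K : T -> Prop) (l : list T) : forall i,
  Forall K l -> Forall K (del i l).
Proof.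
  induction l as [|a l IH]; intros i H; [destruct i; constructor|]. inversion_clear H.
  destruct i as [|i]; simpl; [assumption|]. constructor; auto.
Qed.

Lemma del_map {T T' : Type} (f : T -> T') (l : list T) : forall i,
  del i (map f l) = map f (del i l).
Proof.
  induction l as [|a l IH]; intros i; [destruct i; reflexivity|]. destruct i as [|i]; simpl; [reflexivity|].
  rewrite IH. reflexivity.
Qed.

Lemma del_del {T : Type} (l : list T) : forall i j, (j <= i)%nat ->
  del j (del (S i) l) = del i (del j l).
Proof.
  induction l as [|a l IH]; intros i j H; [destruct i, j; reflexivity|].
  destruct j as [|j]; [reflexivity|]. destruct i as [|i]; [lia|].
  change (a :: del j (del (S i) l) = a :: del i (del j l)). rewrite IH by lia. reflexivity.
Qed.

(** A barycentre is [aff] at constant coordinates, so this is a case of [aff_comp]. It is the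
    property of affine maps behind the naturality of subdivision. *)
Lemma aff_bary w l : aff w (bary l) = bary (map (aff w) l).
Proof.
  assert (E : forall l c, (fun j => c * lsum l j) = aff l (fun _ => c)).
  { clear. induction l as [|v l IH]; intros c; apply functional_extensionality; intros j; simpl;
      [lra|]. change (ptail (fun _ : nat => c)) with (fun _ : nat => c). rewrite <- IH. lra. }
  unfold bary. rewrite !E, aff_comp, length_map. reflexivity.
Qed.

(** * Vanishing relative homology *)

Local Open Scope Z_scope.

Section Families.
Context {X : FiniteT0Space}.

Notation simplex := (simplex X).
Notation chain := (chain X).

Definition along (s : simplex) (w : list point) : simplex := fun t => s (aff w t).

(** Closure under everything that faces and subdivision do to a simplex. Besides [sing A] this
    admits the union of [sing A] and [sing B], which in general comes from no subspace. *)
Record fam (T : nat -> simplex -> Prop) : Prop := {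
  fam_ext : forall n s s', agree X n s s' -> T n s -> T n s';
  fam_along : forall n m s w, T n s -> length w = S m -> Forall (inDelta n) w ->
    T m (along s w)
}.

Lemma agree_along_iota n (s : simplex) : agree X n (along s (iota n)) s.
Proof. intros t Ht. unfold along. rewrite aff_iota; [reflexivity|apply Ht]. Qed.

Lemma agree_along_del n i (s : simplex) : (i <= S n)%nat ->
  agree X n (along s (del i (iota (S n)))) (fun t => s (face i t)).
Proof.
  intros Hi t Ht. unfold along. rewrite <- aff_face by (rewrite iota_length; lia).
  rewrite aff_iota; [reflexivity|]. apply face_inDelta; assumption.
Qed.

Lemma fam_face T : fam T -> forall n s i, T (S n) s -> (i <= S n)%nat ->
  T n (fun t => s (face i t)).
Proof.
  intros HT n s i Hs Hi. eapply fam_ext; [exact HT|apply agree_along_del, Hi|].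
  apply (fam_along T HT (S n)); [exact Hs| |apply del_Forall, iota_inDelta].
  apply eq_add_S. rewrite del_length; rewrite iota_length; lia.
Qed.

Lemma fam_or T T' : fam T -> fam T' -> fam (fun n s => T n s \/ T' n s).
Proof.
  intros H H'. split.
  - intros n s s' E [A|A]; [left|right]; eapply fam_ext; eassumption.
  - intros n m s w [A|A] L F; [left|right]; eapply fam_along; eassumption.
Qed.

Lemma fam_and T T' : fam T -> fam T' -> fam (fun n s => T n s /\ T' n s).
Proof.
  intros H H'. split.
  - intros n s s' E [A A']; split; eapply fam_ext; eassumption.
  - intros n m s w [A A'] L F; split; eapply fam_along; eassumption.
Qed.

Definition lit (T : nat -> simplex -> Prop) (n : nat) (c : chain) : Prop :=
  Forall (fun p => T n (snd p)) c.

(** Only up to equality of chains, since terms outside [T] may be present and cancel; [supp]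
    likewise looks at coefficients. *)
Definition mem (T : nat -> simplex -> Prop) (n : nat) (c : chain) : Prop :=
  exists c', lit T n c' /\ eqv n c c'.

Lemma resp_dg n (g : simplex -> Z) : resp n g -> resp (S n) (dg n g).
Proof.
  intros Hg s s' H. apply asum_ext. intros i Hi. apply Hg. intros t Ht. apply H.
  apply face_inDelta; [lia|assumption].
Qed.

Lemma eqv_bdry n (c c' : chain) : eqv (S n) c c' -> eqv n (bdry X (S n) c) (bdry X (S n) c').
Proof. intros H g Hg. rewrite !ev_bdry. apply H, resp_dg, Hg. Qed.

Lemma mem_lit T n c : lit T n c -> mem T n c.
Proof. intros H. exists c. split; [exact H|]. intros g _. reflexivity. Qed.

Lemma mem_nil T n : mem T n [].
Proof. apply mem_lit. constructor. Qed.

Lemma mem_eqv T n c c' : mem T n c -> eqv n c' c -> mem T n c'.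
Proof.
  intros (d & Hd & E) E'. exists d. split; [exact Hd|]. intros g Hg. rewrite E', E; auto.
Qed.

Lemma mem_mono T T' n c : (forall n s, T n s -> T' n s) -> mem T n c -> mem T' n c.
Proof.
  intros H (d & Hd & E). exists d. split; [|exact E].
  eapply Forall_impl; [|exact Hd]. intros p. apply H.
Qed.

Lemma mem_app T n c d : mem T n c -> mem T n d -> mem T n (c ++ d).
Proof.
  intros (c' & Hc & Ec) (d' & Hd & Ed). exists (c' ++ d'). split.
  - apply Forall_app. split; assumption.
  - intros g Hg. rewrite !ev_app, Ec, Ed; auto.
Qed.

Lemma mem_neg T n c : mem T n c -> mem T n (negc X c).
Proof.
  intros (c' & Hc & Ec). exists (negc X c'). split.
  - apply Forall_forall. intros p Hp. apply in_map_iff in Hp. destruct Hp as [q [<- Hq]].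
    unfold lit in Hc. rewrite Forall_forall in Hc. apply (Hc q Hq).
  - intros g Hg. rewrite !ev_negc, Ec; auto.
Qed.

Lemma mem_bdry T n c : fam T -> mem T (S n) c -> mem T n (bdry X (S n) c).
Proof.
  intros HT (c' & Hc & Ec). exists (bdry X (S n) c'). split; [|apply eqv_bdry, Ec].
  apply Forall_forall. intros p Hp. apply in_flat_map in Hp. destruct Hp as [q [Hq Hp]].
  apply in_map_iff in Hp. destruct Hp as [i [<- Hi]]. apply in_seq in Hi.
  unfold lit in Hc. rewrite Forall_forall in Hc. apply (fam_face T HT n (snd q)); [|lia].
  apply (Hc q Hq).
Qed.

Lemma lit_select T n (P : simplex -> Prop) c : lit T n c ->
  lit (fun n s => T n s /\ P s) n (select P c).
Proof.
  intros H. apply Forall_forall. intros p Hp. apply filter_In in Hp. destruct Hp as [Hp E].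
  unfold lit in H. rewrite Forall_forall in H.
  destruct (excluded_middle_informative (P (snd p))) as [e|e]; [split; auto|discriminate].
Qed.

Lemma mem_or T1 T2 n c : mem (fun n s => T1 n s \/ T2 n s) n c ->
  exists c1 c2, mem T1 n c1 /\ mem T2 n c2 /\ eqv n c (c1 ++ c2).
Proof.
  intros (c' & Hc & Ec). exists (select (T1 n) c'), (select (fun s => ~ T1 n s) c').
  split; [|split].
  - apply mem_lit. eapply Forall_impl; [|apply (lit_select _ n (T1 n) c' Hc)].
    intros p. simpl. tauto.
  - apply mem_lit. eapply Forall_impl; [|apply (lit_select _ n (fun s => ~ T1 n s) c' Hc)].
    intros p. simpl. tauto.
  - intros g Hg. rewrite ev_app, <- ev_split. apply Ec, Hg.
Qed.

(** Of a representative by [T2]-simplices, keep the terms in [T1]. The discarded part evaluates to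
    0: against [g] cut off to simplices outside [T1], the representative by [T1]-simplices gives
    0. *)
Lemma mem_and T1 T2 n c : fam T1 -> mem T1 n c -> mem T2 n c ->
  mem (fun n s => T1 n s /\ T2 n s) n c.
Proof.
  intros HT (c1 & H1 & E1) (c2 & H2 & E2). exists (select (T1 n) c2). split.
  - eapply Forall_impl; [|apply (lit_select _ n (T1 n) c2 H2)]. intros p. simpl. tauto.
  - intros g Hg. rewrite (E2 g Hg), (ev_split (T1 n) g c2).
    cut (ev g (select (fun s => ~ T1 n s) c2) = 0); [lia|]. rewrite ev_select.
    rewrite <- E2, E1.
    + transitivity (ev (fun _ : simplex => 0) c1); [|apply ev_zero].
      apply ev_ext_in. intros p Hp. unfold lit in H1. rewrite Forall_forall in H1.
      specialize (H1 p Hp). simpl in H1.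
      destruct (excluded_middle_informative (~ T1 n (snd p))); [tauto|lia].
    + apply resp_mul; [exact Hg|]. apply resp_indicator.
      intros s s' e H Hs'. apply H. eapply fam_ext; [exact HT|apply agree_sym, e|exact Hs'].
    + apply resp_mul; [exact Hg|]. apply resp_indicator.
      intros s s' e H Hs'. apply H. eapply fam_ext; [exact HT|apply agree_sym, e|exact Hs'].
Qed.

End Families.

Ltac ev_norm_in H :=
  repeat first [rewrite ev_app in H | rewrite ev_negc in H | rewrite ev_bdry in H
               | rewrite ev_bdry_bdry in H].

(* Proves an identity between chains by evaluating it, and the available identities (also one
   degree up, after applying the boundary), at an arbitrary functional. *)
Ltac chain_eq :=
  let g := fresh "g" in let Hg := fresh "Hg" in
  intros g Hg;
  repeat match goal with
  | E : eqv (S ?n) ?a ?b |- _ =>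
      match goal with
      | _ : resp n g |- _ =>
        let E' := fresh "E" in
        pose proof (E (dg n g) (resp_dg n g Hg)) as E'; cbv beta in E';
        ev_norm_in E'; clear E
      end
  | E : eqv ?n ?a ?b |- _ =>
      let E' := fresh "E" in
      pose proof (E g Hg) as E'; cbv beta in E';
      ev_norm_in E'; clear E
  end;
  repeat first [rewrite ev_app | rewrite ev_negc | rewrite ev_bdry | rewrite ev_bdry_bdry]; lia.

(** * Acyclic pairs of families: exact sequence of a triple, and excision *)

Section RelativeHomology.
Context {X : FiniteT0Space}.

Notation simplex := (simplex X).
Notation chain := (chain X).

Definition bmem (T : nat -> simplex -> Prop) (n : nat) (c : chain) : Prop :=
  match n with
  | O => True
  | S m => mem T m (bdry X (S m) c)
  end.

Definition rb (T T' : nat -> simplex -> Prop) (n : nat) (c : chain) : Prop :=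
  exists d e, mem T (S n) d /\ mem T' n e /\ eqv n c (bdry X (S n) d ++ e).

(* [acy T T']: all relative homology groups H_n(T, T') vanish. *)
Definition acy (T T' : nat -> simplex -> Prop) : Prop :=
  forall n c, mem T n c -> bmem T' n c -> rb T T' n c.

Lemma bmem_mono T T' n c : (forall n s, T n s -> T' n s) -> bmem T n c -> bmem T' n c.
Proof. destruct n; [trivial|]. apply mem_mono. Qed.

Lemma acy_iff (T1 T1' T T' : nat -> simplex -> Prop) :
  (forall n s, T1 n s <-> T n s) -> (forall n s, T1' n s <-> T' n s) -> acy T1 T1' -> acy T T'.
Proof.
  intros E E' H n c Hc Bc. destruct (H n c) as (d & e & Hd & He & Ec).
  - eapply mem_mono; [|exact Hc]. apply E.
  - eapply bmem_mono; [|exact Bc]. apply E'.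
  - exists d, e. split; [eapply mem_mono; [|exact Hd]; apply E|].
    split; [eapply mem_mono; [|exact He]; apply E'|exact Ec].
Qed.

Lemma acy_refl (T T' : nat -> simplex -> Prop) : (forall n s, T n s -> T' n s) -> acy T T'.
Proof.
  intros H n c Hc _. exists [], c. split; [apply mem_nil|]. split; [eapply mem_mono; eassumption|].
  intros g _. reflexivity.
Qed.

(** If [c = ∂d + e], the rest [e] has the same boundary as [c], hence is a cycle modulo [T''] and
    can be treated inside [T']. *)
Lemma acy_trans (T T' T'' : nat -> simplex -> Prop) :
  (forall n s, T' n s -> T n s) -> (forall n s, T'' n s -> T' n s) ->
  acy T T' -> acy T' T'' -> acy T T''.
Proof.
  intros I I' H H' n c Hc Bc.
  destruct (H n c Hc (bmem_mono _ _ _ _ I' Bc)) as (d & e & Hd & He & E).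
  assert (Be : bmem T'' n e).
  { destruct n as [|n]; [exact Logic.I|]. eapply mem_eqv; [exact Bc|]. chain_eq. }
  destruct (H' n e He Be) as (d' & e' & Hd' & He' & E').
  exists (d ++ d'), e'. split; [|split; [assumption|]].
  - apply mem_app; [assumption|]. eapply mem_mono; eassumption.
  - chain_eq.
Qed.

(** The boundary of [c] is a cycle of [T'] modulo [T'']; writing it as [∂d + e] makes [c - d] a
    cycle modulo [T'']. *)
Lemma acy_left (T T' T'' : nat -> simplex -> Prop) :
  (forall n s, T' n s -> T n s) -> (forall n s, T'' n s -> T' n s) ->
  acy T T'' -> acy T' T'' -> acy T T'.
Proof.
  intros I I' H H' n c Hc Bc. destruct n as [|n].
  - destruct (H O c Hc Logic.I) as (d & e & Hd & He & E).
    exists d, e. split; [assumption|]. split; [|assumption]. eapply mem_mono; eassumption.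
  - assert (B0 : bmem T'' n (bdry X (S n) c)).
    { destruct n as [|n]; [exact Logic.I|]. eapply mem_eqv; [apply mem_nil|].
      intros g Hg. rewrite !ev_bdry, ev_bdry_bdry. reflexivity. }
    destruct (H' n _ Bc B0) as (d & e & Hd & He & E).
    destruct (H (S n) (c ++ negc X d)) as (x & y & Hx & Hy & E').
    + apply mem_app; [assumption|]. apply mem_neg. eapply mem_mono; eassumption.
    + eapply mem_eqv; [exact He|]. intros g Hg. specialize (E g Hg).
      rewrite ev_app, !ev_bdry in E. rewrite ev_bdry, ev_app, ev_negc. lia.
    + exists x, (d ++ y). split; [assumption|]. split.
      * apply mem_app; [assumption|]. eapply mem_mono; eassumption.
      * clear E. chain_eq.
Qed.

(** No subdivision is involved, because each simplex of [T] already lies in [T1] or [T2]. For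
    [c = c1 + c2] the boundary of [c1] is that of [c] minus that of [c2], so it lies in both
    families and hence in [T0]. *)
Lemma acy_excision (T T1 T2 T0 : nat -> simplex -> Prop) : fam T1 -> fam T2 ->
  (forall n s, T n s -> T1 n s \/ T2 n s) -> (forall n s, T1 n s -> T n s) ->
  (forall n s, T1 n s -> T2 n s -> T0 n s) -> (forall n s, T0 n s -> T2 n s) ->
  acy T1 T0 -> acy T T2.
Proof.
  intros F1 F2 I I1 I2 I0 H n c Hc Bc.
  destruct (mem_or T1 T2 n c (mem_mono _ _ _ _ I Hc)) as (c1 & c2 & H1 & H2 & E).
  destruct (H n c1 H1) as (d & e & Hd & He & E').
  - destruct n as [|n]; [exact Logic.I|]. cbn [bmem] in *.
    apply (mem_mono (fun n s => T1 n s /\ T2 n s)); [intros ? ? []; auto|].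
    apply mem_and; [assumption|apply mem_bdry; assumption|].
    apply (mem_eqv _ _ (bdry X (S n) c ++ negc X (bdry X (S n) c2))).
    + apply mem_app; [assumption|]. apply mem_neg, mem_bdry; assumption.
    + chain_eq.
  - exists d, (e ++ c2). split; [eapply mem_mono; eassumption|]. split.
    + apply mem_app; [eapply mem_mono; eassumption|assumption].
    + chain_eq.
Qed.

End RelativeHomology.

(** * Barycentric subdivision *)

(* The factor [1] gives the summands the shape required by [ev_alternating]. *)
Definition abdry (n : nat) (l : list point) : list (Z * list point) :=
  match n with
  | O => []
  | S _ => map (fun i => ((-1) ^ Z.of_nat i * 1, del i l)) (seq 0 (S n))
  end.

(** The barycentre is joined to the subdivided boundary and placed first, so that deleting entry 0
    returns the base of the cone. *)
Fixpoint sd (n : nat) (l : list point) : list (Z * list point) :=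
  match n with
  | O => [(1, l)]
  | S m => mapb (cons (bary l)) (lin (sd m) (abdry n l))
  end.

(* The chain homotopy between the identity and barycentric subdivision. *)
Fixpoint sdh (n : nat) (l : list point) : list (Z * list point) :=
  match n with
  | O => []
  | S m => mapb (cons (bary l)) ((1, l) :: scale (-1) (lin (sdh m) (abdry n l)))
  end.

Definition adg (n : nat) (G : list point -> Z) : list point -> Z :=
  fun w => asum (S (S n)) (fun i => G (del i w)).

Lemma ev_abdry n (G : list point -> Z) l : ev G (abdry (S n) l) = adg n G l.
Proof.
  unfold abdry. rewrite ev_alternating. change (Z.of_nat 0) with 0. rewrite Z.pow_0_r.
  unfold adg. cbn [Nat.add]. lia.
Qed.

Lemma abdry_length n l p : length l = S (S n) -> In p (abdry (S n) l) -> length (snd p) = S n.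
Proof.
  intros Hl Hp. apply in_map_iff in Hp. destruct Hp as [i [<- Hi]]. apply in_seq in Hi.
  cbn [snd]. apply eq_add_S. rewrite del_length by lia. exact Hl.
Qed.

(** Dual form of ∂h + h∂ = id - sd. Insert h(l) = b(l - h∂l) and ∂(bw) = w - b∂w, where b is the
    prefixed barycentre. The induction hypothesis on the faces replaces ∂h∂l by ∂l - sd∂l - h∂∂l,
    and h∂∂l is 0. *)
Lemma sd_sdh n : forall l (G : list point -> Z), length l = S n ->
  ev (adg n G) (sdh n l) + ev (fun x => ev G (sdh (pred n) x)) (abdry n l)
  = G l - ev G (sd n l).
Proof.
  induction n as [|n IH]; intros l G Hl; [cbn [sdh sd abdry ev fold_right fst snd]; lia|].
  cbn [sd sdh]. rewrite !ev_mapb, ev_lin. cbn [pred].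
  set (b := bary l).
  assert (C : forall w, adg (S n) G (b :: w) = G w - adg n (fun u => G (b :: u)) w)
    by reflexivity.
  rewrite (ev_ext _ _ _ C), ev_sub. cbn [ev fold_right fst snd].
  change (fold_right _ 0 ?c) with (ev G c) at 1.
  rewrite !ev_scale, !ev_lin.
  match goal with |- context [fold_right ?f 0 ?c] =>
    change (fold_right f 0 c) with (ev (adg n (fun u => G (b :: u))) c) end.
  rewrite ev_scale, ev_lin.
  assert (E : ev (fun x => ev (adg n (fun u => G (b :: u))) (sdh n x)) (abdry (S n) l)
    = ev (fun x => G (b :: x) - ev (fun u => G (b :: u)) (sd n x)
                   - ev (fun y => ev (fun u => G (b :: u)) (sdh (pred n) y)) (abdry n x))
         (abdry (S n) l)).
  { apply ev_ext_in. intros p Hp. rewrite <- (IH (snd p) (fun u => G (b :: u))); [lia|].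
    eapply abdry_length; eassumption. }
  rewrite E, !ev_sub.
  assert (Z0 : ev (fun x => ev (fun y => ev (fun u => G (b :: u)) (sdh (pred n) y)) (abdry n x))
                  (abdry (S n) l) = 0).
  { destruct n as [|n]; [apply ev_zero|].
    rewrite ev_abdry. unfold adg at 1.
    erewrite asum_ext by (intros i Hi; apply ev_abdry).
    apply (asum_asum (S (S n)) (fun i j => ev (fun u => G (b :: u)) (sdh (pred (S n)) (del j (del i l))))).
    intros i j Hj Hi. rewrite del_del by assumption. reflexivity. }
  rewrite Z0, (ev_abdry n (fun x => G (b :: x))). lia.
Qed.

Lemma abdry_map (f : point -> point) n l :
  abdry n (map f l) = mapb (map f) (abdry n l).
Proof.
  destruct n as [|n]; [reflexivity|]. unfold abdry, mapb. rewrite map_map. apply map_ext.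
  intros i. cbn [fst snd]. rewrite del_map. reflexivity.
Qed.

Lemma lin_mapb {B B' C C' : Type} (F : B -> list (Z * C)) (F' : B' -> list (Z * C'))
  (f : B -> B') (h : C -> C') (c : list (Z * B)) :
  (forall b, F' (f b) = mapb h (F b)) -> lin F' (mapb f c) = mapb h (lin F c).
Proof.
  intros H. unfold lin. induction c as [|p c IH]; [reflexivity|].
  cbn [mapb map flat_map fst snd]. fold (mapb f c). rewrite IH, H.
  unfold mapb, scale. rewrite map_app, !map_map. reflexivity.
Qed.

Lemma mapb_mapb {A B C : Type} (f : A -> B) (g : B -> C) (c : list (Z * A)) :
  mapb g (mapb f c) = mapb (fun a => g (f a)) c.
Proof. unfold mapb. rewrite map_map. reflexivity. Qed.

Lemma sd_map (f : point -> point) (Hf : forall l, f (bary l) = bary (map f l)) n : forall l,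
  sd n (map f l) = mapb (map f) (sd n l).
Proof.
  induction n as [|n IH]; intros l; [reflexivity|].
  cbn [sd]. rewrite abdry_map, (lin_mapb (sd n) (sd n) (map f) (map f)) by apply IH.
  rewrite !mapb_mapb. cbn [map]. rewrite Hf. reflexivity.
Qed.

Lemma sdh_map (f : point -> point) (Hf : forall l, f (bary l) = bary (map f l)) n : forall l,
  sdh n (map f l) = mapb (map f) (sdh n l).
Proof.
  induction n as [|n IH]; intros l; [reflexivity|].
  cbn [sdh]. rewrite abdry_map, (lin_mapb (sdh n) (sdh n) (map f) (map f)) by apply IH.
  cbn [mapb map fst snd]. rewrite Hf. f_equal.
  unfold mapb, scale. rewrite !map_map. cbn [fst snd map]. rewrite Hf. reflexivity.
Qed.

Lemma in_abdry n l p : In p (abdry (S n) l) -> exists i, (i <= S n)%nat /\ snd p = del i l.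
Proof.
  intros Hp. apply in_map_iff in Hp. destruct Hp as [i [<- Hi]]. apply in_seq in Hi.
  exists i. split; [lia|reflexivity].
Qed.

Lemma in_sd_S n l p : In p (sd (S n) l) ->
  exists i q, (i <= S n)%nat /\ In q (sd n (del i l)) /\ snd p = bary l :: snd q.
Proof.
  intros Hp. apply in_mapb in Hp. destruct Hp as [q [Hq E]].
  apply in_lin in Hq. destruct Hq as (r & q' & Hr & Hq' & E').
  apply in_abdry in Hr. destruct Hr as (i & Hi & Er). rewrite Er in Hq'.
  exists i, q'. rewrite E, E'. auto.
Qed.

Lemma in_sdh_S n l p : In p (sdh (S n) l) ->
  snd p = bary l :: l \/
  exists i q, (i <= S n)%nat /\ In q (sdh n (del i l)) /\ snd p = bary l :: snd q.
Proof.
  intros Hp. apply in_mapb in Hp. destruct Hp as [q [[<-|Hq] E]]; [left; exact E|right].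
  apply in_map_iff in Hq. destruct Hq as [q0 [<- Hq]].
  apply in_lin in Hq. destruct Hq as (r & q' & Hr & Hq' & E').
  apply in_abdry in Hr. destruct Hr as (i & Hi & Er). rewrite Er in Hq'.
  exists i, q'. rewrite E. cbn [snd]. rewrite E'. auto.
Qed.

Lemma sd_length n : forall l p, length l = S n -> In p (sd n l) -> length (snd p) = S n.
Proof.
  induction n as [|n IH]; intros l p Hl Hp.
  - destruct Hp as [<-|[]]. exact Hl.
  - apply in_sd_S in Hp. destruct Hp as (i & q & Hi & Hq & ->). cbn [length]. f_equal.
    apply (IH (del i l)); [|exact Hq]. apply eq_add_S. rewrite del_length by lia. exact Hl.
Qed.

Lemma sdh_length n : forall l p, length l = S n -> In p (sdh n l) -> length (snd p) = S (S n).
Proof.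
  induction n as [|n IH]; intros l p Hl Hp; [destruct Hp|].
  apply in_sdh_S in Hp. destruct Hp as [->|(i & q & Hi & Hq & ->)]; cbn [length]; f_equal;
    [exact Hl|]. apply (IH (del i l)); [|exact Hq]. apply eq_add_S. rewrite del_length by lia. exact Hl.
Qed.

(** Convexity with respect to barycentres only, the points that subdivision adds. *)
Definition bconvex (K : point -> Prop) : Prop :=
  forall l, l <> [] -> Forall K l -> K (bary l).

Lemma sd_convex (K : point -> Prop) n : bconvex K -> forall l p,
  length l = S n -> Forall K l -> In p (sd n l) -> Forall K (snd p).
Proof.
  intros HK. induction n as [|n IH]; intros l p Hl Kl Hp.
  - destruct Hp as [<-|[]]. exact Kl.
  - apply in_sd_S in Hp. destruct Hp as (i & q & Hi & Hq & ->). constructor.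
    + apply HK; [|exact Kl]. intros ->. discriminate.
    + apply (IH (del i l)); [|apply del_Forall, Kl|exact Hq].
      apply eq_add_S. rewrite del_length by lia. exact Hl.
Qed.

Lemma sdh_convex (K : point -> Prop) n : bconvex K -> forall l p,
  length l = S n -> Forall K l -> In p (sdh n l) -> Forall K (snd p).
Proof.
  intros HK. induction n as [|n IH]; intros l p Hl Kl Hp; [destruct Hp|].
  assert (Kb : K (bary l)) by (apply HK; [intros ->; discriminate|exact Kl]).
  apply in_sdh_S in Hp. destruct Hp as [->|(i & q & Hi & Hq & ->)]; constructor; auto.
  apply (IH (del i l)); [|apply del_Forall, Kl|exact Hq].
  apply eq_add_S. rewrite del_length by lia. exact Hl.
Qed.

(** * Subdivision shrinks simplices *)

Local Open Scope R_scope.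

Lemma bary_le (M : R) j l : l <> [] -> (forall v, In v l -> v j <= M) -> bary l j <= M.
Proof.
  intros Hl H.
  assert (P : 0 < INR (length l)).
  { destruct l; [congruence|]. apply lt_0_INR. simpl. lia. }
  assert (E : lsum l j <= INR (length l) * M).
  { clear Hl P. induction l as [|v l IH]; [simpl; lra|]. cbn [length lsum]. rewrite S_INR.
    assert (v j <= M) by (apply H; left; reflexivity).
    assert (lsum l j <= INR (length l) * M) by (apply IH; intros u Hu; apply H; right; exact Hu).
    lra. }
  unfold bary. apply (Rmult_le_reg_l (INR (length l))); [exact P|].
  rewrite <- Rmult_assoc, Rinv_r, Rmult_1_l by (apply Rgt_not_eq, P). exact E.
Qed.

Lemma bary_opp j l : bary (map (fun v i => - v i) l) j = - bary l j.
Proof.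
  unfold bary. rewrite length_map.
  assert (E : lsum (map (fun v i => - v i) l) j = - lsum l j).
  { induction l as [|v l IH]; simpl; [lra|]. rewrite IH. lra. }
  rewrite E. ring.
Qed.

Lemma bary_ge (M : R) j l : l <> [] -> (forall v, In v l -> M <= v j) -> M <= bary l j.
Proof.
  intros Hl H. cut (- bary l j <= - M); [lra|]. rewrite <- bary_opp. apply bary_le.
  - intros E. apply map_eq_nil in E. contradiction.
  - intros v Hv. apply in_map_iff in Hv. destruct Hv as [u [<- Hu]]. specialize (H u Hu). lra.
Qed.

Lemma bconvex_slab (p e : R) j : bconvex (fun q => Rabs (q j - p) <= e).
Proof.
  intros l Hl H. rewrite Forall_forall in H.
  assert (bary l j <= p + e).
  { apply bary_le; [assumption|]. intros v Hv. specialize (H v Hv).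
    unfold Rabs in H; destruct (Rcase_abs _) in H; lra. }
  assert (p - e <= bary l j).
  { apply bary_ge; [assumption|]. intros v Hv. specialize (H v Hv).
    unfold Rabs in H; destruct (Rcase_abs _) in H; lra. }
  apply Rabs_le. lra.
Qed.

Lemma bary_as_aff l : bary l = aff l (fun i => if (i <? length l)%nat then / INR (length l) else 0).
Proof.
  assert (E : forall c l t, (forall i, (i < length l)%nat -> t i = c) ->
              (fun j => c * lsum l j) = aff l t).
  { clear. intros c l. induction l as [|v l IH]; intros t Ht; apply functional_extensionality;
      intros j; simpl; [lra|].
    rewrite <- (IH (ptail t)) by (intros i Hi; apply Ht; simpl; lia).
    rewrite (Ht O) by (simpl; lia). lra. }
  apply E. intros i Hi. destruct (Nat.ltb_spec i (length l)); [reflexivity|lia].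
Qed.

Lemma bconvex_inDelta n : bconvex (inDelta n).
Proof.
  intros l Hl H. rewrite bary_as_aff. destruct (length l) as [|m] eqn:E.
  { apply length_zero_iff_nil in E. contradiction. }
  apply (aff_inDelta n m); [exact E| |exact H].
  assert (P : 0 < / INR (S m)) by (apply Rinv_0_lt_compat, lt_0_INR; lia).
  split; [|split].
  - intros i Hi. destruct (Nat.ltb_spec i (S m)); [lra|lia].
  - intros i Hi. destruct (Nat.ltb_spec i (S m)); [lia|lra].
  - rewrite psum_sum. rewrite (psum_ext _ _ (fun _ => / INR (S m))).
    + transitivity (INR (S m) * / INR (S m)); [|apply Rinv_r, not_0_INR; lia].
      generalize (/ INR (S m)). intros c. clear. induction (S m) as [|k IH]; [simpl; lra|].
      rewrite S_INR. simpl psum. change (ptail (fun _ : nat => c)) with (fun _ : nat => c).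
      rewrite IH. lra.
    + intros i Hi. destruct (Nat.ltb_spec i (S m)); [reflexivity|lia].
Qed.

Definition width (d : R) (l : list point) : Prop :=
  forall p q j, In p l -> In q l -> Rabs (p j - q j) <= d.

Lemma in_del {T : Type} (l : list T) : forall i x, In x (del i l) -> In x l.
Proof.
  induction l as [|a l IH]; intros i x H; [destruct i; exact H|].
  destruct i as [|i]; simpl in *; [right; exact H|]. destruct H as [H|H]; eauto.
Qed.

(** The difference is the mean of the n + 1 vectors [u - v] over the vertices [u]. The one for
    [u = v] is 0, which leaves n vectors of size at most [d] and gives the factor n / (n + 1). *)
Lemma bary_width d n l v j : length l = S n -> width d l -> In v l ->
  Rabs (bary l j - v j) <= INR n / INR (S n) * d.
Proof.
  intros Hl W Hv. unfold bary. rewrite Hl.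
  assert (P : 0 < INR (S n)) by (apply lt_0_INR; lia).
  assert (E : Rabs (lsum l j - INR (length l) * v j) <= INR (pred (length l)) * d).
  { clear Hl P.
    assert (A : forall m, (forall u, In u m -> In u l) ->
              Rabs (lsum m j - INR (length m) * v j) <= INR (length m) * d).
    { induction m as [|u m IH]; intros Hm.
      - simpl. rewrite Rmult_0_l, Rminus_0_r, Rabs_R0. lra.
      - cbn [length lsum]. rewrite S_INR.
        replace (u j + lsum m j - (INR (length m) + 1) * v j)
          with ((u j - v j) + (lsum m j - INR (length m) * v j)) by lra.
        eapply Rle_trans; [apply Rabs_triang|].
        assert (Rabs (u j - v j) <= d) by (apply W; [apply Hm; left; reflexivity|exact Hv]).
        specialize (IH (fun w Hw => Hm w (or_intror Hw))). lra. }
    apply in_split in Hv. destruct Hv as (l1 & l2 & E).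
    specialize (A (l1 ++ l2)).
    assert (L : lsum l j = v j + lsum (l1 ++ l2) j).
    { rewrite E. clear. induction l1 as [|u l1 IH]; simpl; [reflexivity|]. rewrite IH. lra. }
    assert (L' : length l = S (length (l1 ++ l2))).
    { rewrite E, !length_app. simpl. lia. }
    rewrite L, L', S_INR. cbn [pred].
    replace (v j + lsum (l1 ++ l2) j - (INR (length (l1 ++ l2)) + 1) * v j)
      with (lsum (l1 ++ l2) j - INR (length (l1 ++ l2)) * v j) by lra.
    apply A. intros u Hu. rewrite E. apply in_or_app. apply in_app_or in Hu.
    destruct Hu; [left|right; right]; assumption. }
  rewrite Hl in E. cbn [pred] in E.
  replace (/ INR (S n) * lsum l j - v j) with (/ INR (S n) * (lsum l j - INR (S n) * v j))
    by (field; lra).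
  rewrite Rabs_mult, (Rabs_right (/ INR (S n)))
    by (apply Rle_ge, Rlt_le, Rinv_0_lt_compat; exact P).
  replace (INR n / INR (S n) * d) with (/ INR (S n) * (INR n * d)) by (field; lra).
  apply Rmult_le_compat_l; [apply Rlt_le, Rinv_0_lt_compat; exact P|exact E].
Qed.

(** Two distinct entries of a small simplex either both come from the subdivision of a face, where
    induction applies, or one is the barycentre of [l]. In the latter case the slab around the
    barycentre that contains the face also contains its subdivision. *)
Lemma sd_width d n : 0 <= d -> forall l p, length l = S n -> width d l -> In p (sd n l) ->
  width (INR n / INR (S n) * d) (snd p).
Proof.
  intros Hd. induction n as [|n IH]; intros l p Hl W Hp.
  - destruct Hp as [<-|[]]. cbn [snd]. destruct l as [|v [|w l]]; try discriminate.
    intros q r j [<-|[]] [<-|[]]. rewrite Rminus_diag, Rabs_R0. simpl. lra.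
  - apply in_sd_S in Hp. destruct Hp as (i & q & Hi & Hq & ->).
    assert (Ld : length (del i l) = S n) by (apply eq_add_S; rewrite del_length by lia; exact Hl).
    assert (B : forall r j, In r (snd q) ->
              Rabs (bary l j - r j) <= INR (S n) / INR (S (S n)) * d).
    { intros r j Hr. rewrite Rabs_minus_sym.
      assert (F := sd_convex _ n (bconvex_slab (bary l j) (INR (S n) / INR (S (S n)) * d) j)
                     (del i l) q Ld).
      lapply F; [intros F'; specialize (F' Hq); rewrite Forall_forall in F'; apply F', Hr|].
      apply Forall_forall. intros u Hu. rewrite Rabs_minus_sym.
      apply bary_width; [exact Hl|exact W|]. eapply in_del, Hu. }
    assert (W' : width (INR n / INR (S n) * d) (snd q)).
    { apply (IH (del i l)); [exact Ld| |exact Hq]. intros u v j Hu Hv.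
      apply W; eapply in_del; eassumption. }
    assert (Mon : INR n / INR (S n) * d <= INR (S n) / INR (S (S n)) * d).
    { apply Rmult_le_compat_r; [exact Hd|]. rewrite !S_INR. pose proof (pos_INR n).
      apply (Rmult_le_reg_r ((INR n + 1) * (INR n + 1 + 1))); [nra|]. field_simplify; nra. }
    intros u v j [<-|Hu] [<-|Hv].
    + rewrite Rminus_diag, Rabs_R0.
      assert (0 <= INR (S n) / INR (S (S n))).
      { apply Rmult_le_pos; [apply pos_INR|]. apply Rlt_le, Rinv_0_lt_compat, lt_0_INR. lia. }
      nra.
    + apply B, Hv.
    + rewrite Rabs_minus_sym. apply B, Hu.
    + eapply Rle_trans; [apply W'; assumption|exact Mon].
Qed.

(** * Small simplices *)

Local Open Scope Z_scope.

Section SmallSimplices.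
Context {X : FiniteT0Space}.

Notation simplex := (simplex X).
Notation chain := (chain X).

Definition ssd (n : nat) (c : chain) : chain :=
  lin (fun s => mapb (along s) (sd n (iota n))) c.

Definition ssdh (n : nat) (c : chain) : chain :=
  lin (fun s => mapb (along s) (sdh n (iota n))) c.

Lemma along_along (s : simplex) w v : along (along s w) v = along s (map (aff w) v).
Proof. unfold along. apply functional_extensionality. intros t. rewrite aff_comp. reflexivity. Qed.

Lemma in_sd_iota n p : In p (sd n (iota n)) ->
  length (snd p) = S n /\ Forall (inDelta n) (snd p).
Proof.
  intros Hp. split; [eapply sd_length; [apply iota_length|exact Hp]|].
  eapply sd_convex; [apply bconvex_inDelta|apply iota_length|apply iota_inDelta|exact Hp].
Qed.

Lemma in_sdh_iota n p : In p (sdh n (iota n)) ->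
  length (snd p) = S (S n) /\ Forall (inDelta n) (snd p).
Proof.
  intros Hp. split; [eapply sdh_length; [apply iota_length|exact Hp]|].
  eapply sdh_convex; [apply bconvex_inDelta|apply iota_length|apply iota_inDelta|exact Hp].
Qed.

Lemma agree_along n m (s s' : simplex) w : agree X n s s' ->
  length w = S m -> Forall (inDelta n) w -> agree X m (along s w) (along s' w).
Proof. intros H L F t Ht. apply H. eapply aff_inDelta; eassumption. Qed.

(** The homotopy for [iota n], pushed forward along each simplex. The boundary term needs
    naturality: a face of [s] is subdivided on its own standard simplex, a face of [iota n] in
    place. *)
Lemma ssd_ssdh n c (g : simplex -> Z) : resp n g ->
  ev (dg n g) (ssdh n c) + ev g (ssdh (pred n) (bdry X n c)) = ev g c - ev g (ssd n c).
Proof.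
  intros Hg.
  assert (B : forall s, ev (dg n g) (mapb (along s) (sdh n (iota n)))
    + ev (fun x => ev (fun w => g (along s w)) (sdh (pred n) x)) (abdry n (iota n))
    = g s - ev g (mapb (along s) (sd n (iota n)))).
  { intros s. rewrite !ev_mapb.
    pose proof (sd_sdh n (iota n) (fun w => g (along s w)) (iota_length n)) as E.
    cbv beta in E. rewrite <- (Hg _ _ (agree_along_iota n s)), <- E.
    f_equal. apply ev_ext_in. intros p Hp. apply in_sdh_iota in Hp. destruct Hp as [L _].
    apply asum_ext. intros i Hi. f_equal. apply functional_extensionality. intros t.
    unfold along. rewrite aff_face by lia. reflexivity. }
  assert (C : ev g (ssdh (pred n) (bdry X n c))
    = ev (fun s => ev (fun x => ev (fun w => g (along s w)) (sdh (pred n) x)) (abdry n (iota n))) c).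
  { destruct n as [|n]; [simpl; rewrite ev_zero; reflexivity|]. cbn [pred].
    unfold ssdh. rewrite ev_lin, ev_bdry. apply ev_ext. intros s. rewrite ev_abdry.
    apply asum_ext. intros i Hi. rewrite ev_mapb.
    rewrite <- (map_aff_iota n (del i (iota (S n)))).
    - rewrite sdh_map by (intros; apply aff_bary). rewrite ev_mapb.
      apply ev_ext_in. intros p Hp. apply in_sdh_iota in Hp. destruct Hp as [L F].
      rewrite <- along_along. apply Hg. apply (agree_along n); [|exact L|exact F].
      apply agree_sym, agree_along_del. lia.
    - apply eq_add_S. rewrite del_length; rewrite iota_length; lia. }
  rewrite C. unfold ssdh, ssd. rewrite !ev_lin, <- ev_add, <- ev_sub.
  apply ev_ext. intros s. apply B.
Qed.

Lemma ssd_lit T n c : fam T -> lit T n c -> lit T n (ssd n c).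
Proof.
  intros HT Hc. apply Forall_forall. intros p Hp. apply in_lin in Hp.
  destruct Hp as (q & r & Hq & Hr & ->). apply in_mapb in Hr. destruct Hr as (x & Hx & ->).
  apply in_sd_iota in Hx. unfold lit in Hc. rewrite Forall_forall in Hc.
  apply (fam_along T HT n); [apply (Hc q Hq)|apply Hx|apply Hx].
Qed.

Lemma ssdh_lit T n c : fam T -> lit T n c -> lit T (S n) (ssdh n c).
Proof.
  intros HT Hc. apply Forall_forall. intros p Hp. apply in_lin in Hp.
  destruct Hp as (q & r & Hq & Hr & ->). apply in_mapb in Hr. destruct Hr as (x & Hx & ->).
  apply in_sdh_iota in Hx. unfold lit in Hc. rewrite Forall_forall in Hc.
  apply (fam_along T HT n); [apply (Hc q Hq)|apply Hx|apply Hx].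
Qed.

Lemma ssdh_eqv n c c' : eqv n c c' -> eqv (S n) (ssdh n c) (ssdh n c').
Proof.
  intros H g Hg. unfold ssdh. rewrite !ev_lin. apply H. intros s s' E.
  rewrite !ev_mapb. apply ev_ext_in. intros p Hp. apply in_sdh_iota in Hp.
  apply Hg. apply (agree_along n); [exact E|apply Hp|apply Hp].
Qed.

Lemma ssdh_mem T n c : fam T -> mem T n c -> mem T (S n) (ssdh n c).
Proof.
  intros HT (c' & Hc & E). exists (ssdh n c'). split; [apply ssdh_lit; assumption|].
  apply ssdh_eqv, E.
Qed.

Fixpoint subdivides (T : nat -> simplex -> Prop) (k n : nat) (s : simplex) : Prop :=
  match k with
  | O => T n s
  | S k' => forall p, In p (sd n (iota n)) -> subdivides T k' n (along s (snd p))
  end.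

Lemma subdivides_le T n : fam T -> forall k k' s, (k <= k')%nat ->
  subdivides T k n s -> subdivides T k' n s.
Proof.
  intros HT k k' s Hk. revert s.
  assert (St : forall k s, subdivides T k n s -> subdivides T (S k) n s).
  { intros m. induction m as [|m IH]; intros s Hs p Hp.
    - apply in_sd_iota in Hp. apply (fam_along T HT n); [exact Hs|apply Hp|apply Hp].
    - apply IH, Hs, Hp. }
  induction Hk as [|k' Hk IH]; auto.
Qed.

(** Induction on the depth through c = ∂hc + h∂c + sd c. The middle term lies in [T'] because ∂c
    does, and sd c needs one subdivision less. *)
Lemma subdivides_acy (T T' : nat -> simplex -> Prop) : fam T -> fam T' ->
  (forall n s, T' n s -> T n s) ->
  forall k n c, lit T n c -> lit (fun n s => subdivides T' k n s) n c -> bmem T' n c ->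
  rb T T' n c.
Proof.
  intros HT HT' I. induction k as [|k IH]; intros n c Hc Hk Bc.
  - exists [], c. split; [apply mem_nil|]. split; [apply mem_lit; exact Hk|].
    intros g _. reflexivity.
  - assert (E : eqv n c (bdry X (S n) (ssdh n c) ++ ssdh (pred n) (bdry X n c) ++ ssd n c)).
    { intros g Hg. rewrite !ev_app, ev_bdry. pose proof (ssd_ssdh n c g Hg). lia. }
    assert (M : mem T' n (ssdh (pred n) (bdry X n c))).
    { destruct n as [|n]; [apply mem_nil|]. apply ssdh_mem; assumption. }
    destruct (IH n (ssd n c)) as (d & e & Hd & He & E').
    + apply ssd_lit; assumption.
    + apply Forall_forall. intros p Hp. apply in_lin in Hp.
      destruct Hp as (q & r & Hq & Hr & ->). apply in_mapb in Hr. destruct Hr as (x & Hx & ->).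
      unfold lit in Hk. rewrite Forall_forall in Hk. apply (Hk q Hq x Hx).
    + destruct n as [|n]; [exact Logic.I|]. cbn [bmem] in *.
      apply (mem_eqv _ _ (bdry X (S n) c ++
               negc X (bdry X (S n) (ssdh (pred (S n)) (bdry X (S n) c))))).
      * apply mem_app; [exact Bc|]. apply mem_neg, mem_bdry; assumption.
      * chain_eq.
    + exists (ssdh n c ++ d), (ssdh (pred n) (bdry X n c) ++ e). split; [|split].
      * apply mem_app; [apply mem_lit, ssdh_lit|]; assumption.
      * apply mem_app; assumption.
      * chain_eq.
Qed.

(** * Uniform smallness from local smallness *)

Local Open Scope R_scope.

Lemma Un_cv_slab (u : nat -> R) (l a e : R) (k : nat) : Un_cv u l ->
  (forall m, (k <= m)%nat -> Rabs (u m - a) <= e) -> Rabs (l - a) <= e.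
Proof.
  intros Hu H. apply Rnot_lt_le. intros Hlt.
  destruct (Hu (Rabs (l - a) - e)) as [N HN]; [lra|].
  specialize (HN (max N k) (Nat.le_max_l _ _)). specialize (H (max N k) (Nat.le_max_r _ _)).
  unfold Rdist in HN. rewrite Rabs_minus_sym in HN.
  pose proof (Rabs_triang (l - u (max N k)) (u (max N k) - a)) as Ht.
  replace (l - u (max N k) + (u (max N k) - a)) with (l - a) in Ht by lra. lra.
Qed.

(** In each coordinate, the slab of radius [rho ^ k] around a vertex of [L k] contains all later
    simplices, so any choice of vertices is a Cauchy sequence. Its limit stays in the standard
    simplex because the defining conditions are closed. *)
Lemma nested_limit n (L : nat -> list point) :
  (forall k, length (L k) = S n) -> Forall (inDelta n) (L O) ->
  (forall k, exists p, In p (sd n (L k)) /\ L (S k) = snd p) ->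
  exists x, inDelta n x /\ forall eps, 0 < eps ->
    exists k, forall v j, In v (L k) -> Rabs (v j - x j) <= eps.
Proof.
  intros HL H0 HS. set (rho := INR n / INR (S n)).
  assert (Hrho : 0 <= rho < 1).
  { unfold rho. rewrite S_INR. pose proof (pos_INR n).
    split; [apply Rmult_le_pos; [assumption|apply Rlt_le, Rinv_0_lt_compat; lra]|].
    apply (Rmult_lt_reg_r (INR n + 1)); [lra|]. unfold Rdiv.
    rewrite Rmult_assoc, Rinv_l by lra. lra. }
  assert (Hpow : forall k, 0 <= rho ^ k) by (intros k; apply pow_le; lra).
  assert (D : forall k, Forall (inDelta n) (L k)).
  { induction k as [|k IH]; [exact H0|]. destruct (HS k) as (p & Hp & ->).
    eapply sd_convex; [apply bconvex_inDelta|apply HL|exact IH|exact Hp]. }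
  assert (W : forall k, width (rho ^ k) (L k)).
  { induction k as [|k IH].
    - intros p q j Hp Hq. rewrite Forall_forall in H0.
      pose proof (inDelta_le1 n p j (H0 p Hp)). pose proof (inDelta_le1 n q j (H0 q Hq)).
      simpl. apply Rabs_le. lra.
    - destruct (HS k) as (p & Hp & ->). simpl.
      apply (sd_width (rho ^ k) n (Hpow k) (L k)); [apply HL|exact IH|exact Hp]. }
  assert (Nest : forall K, bconvex K -> forall k m, (k <= m)%nat -> Forall K (L k) ->
                 Forall K (L m)).
  { intros K HK k m Hm Hk. induction Hm as [|m Hm IH]; [exact Hk|].
    destruct (HS m) as (p & Hp & ->). eapply sd_convex; [exact HK|apply HL|exact IH|exact Hp]. }
  (* The first vertex represents each simplex; the default of [hd] never occurs, because the lists
     have length [S n]. *)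
  set (u := fun k => hd (fun _ => 0) (L k)).
  assert (Hu : forall k, In (u k) (L k)).
  { intros k. unfold u. specialize (HL k). destruct (L k); [discriminate|left; reflexivity]. }
  assert (Near : forall k m v w j, (k <= m)%nat -> In v (L k) -> In w (L m) ->
                 Rabs (w j - v j) <= rho ^ k).
  { intros k m v w j Hm Hv Hw.
    pose proof (Nest _ (bconvex_slab (v j) (rho ^ k) j) k m Hm) as F.
    rewrite !Forall_forall in F. apply F; [|exact Hw].
    intros x Hx. apply W; assumption. }
  assert (Small : forall eps, 0 < eps -> exists k, rho ^ k < eps).
  { intros eps He. destruct (pow_lt_1_zero rho) with (y := eps) as [N HN];
      [rewrite Rabs_right; lra|exact He|]. exists N. specialize (HN N (le_n N)).
    rewrite Rabs_right in HN; [exact HN|]. apply Rle_ge, Hpow. }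
  assert (Lim : forall j, { x | Un_cv (fun k => u k j) x }).
  { intros j. apply R_complete. intros eps He. destruct (Small eps He) as [N HN].
    exists N.
    assert (S1 : forall a b, (N <= a)%nat -> (a <= b)%nat -> Rdist (u b j) (u a j) < eps).
    { intros a b Ha Hb. unfold Rdist.
      eapply Rle_lt_trans; [apply (Near a b); auto|].
      eapply Rle_lt_trans; [|exact HN].
      replace a with (N + (a - N))%nat by lia. rewrite pow_add.
      assert (rho ^ (a - N) <= 1) by (rewrite <- (pow1 (a - N)); apply pow_incr; lra).
      specialize (Hpow N). nra. }
    intros a b Ha Hb. destruct (le_ge_dec a b) as [C|C].
    - rewrite Rdist_sym. apply S1; assumption.
    - apply S1; assumption. }
  set (x := fun j => proj1_sig (Lim j)).
  assert (Hx : forall k v j, In v (L k) -> Rabs (x j - v j) <= rho ^ k).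
  { intros k v j Hv. apply (Un_cv_slab (fun k => u k j) _ _ _ k).
    - exact (proj2_sig (Lim j)).
    - intros m Hm. apply (Near k m); auto. }
  (* Equations pass to the limit in this form, with an error of at most [c * rho ^ k] for every [k].
     Dividing by [c + 1] covers [c = 0] as well. *)
  assert (Zero : forall a c, 0 <= c -> (forall k, Rabs a <= c * rho ^ k) -> a = 0).
  { intros a c Hc Ha. destruct (Req_dec a 0) as [E|E]; [exact E|exfalso].
    apply Rabs_pos_lt in E. destruct (Small (Rabs a / (c + 1))) as [k Hk].
    - apply Rdiv_lt_0_compat; lra.
    - specialize (Ha k). apply (Rmult_lt_compat_r (c + 1)) in Hk; [|lra].
      unfold Rdiv in Hk. rewrite Rmult_assoc, Rinv_l in Hk by lra. specialize (Hpow k). nra. }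
  assert (Du : forall k, inDelta n (u k)).
  { intros k. specialize (D k). rewrite Forall_forall in D. apply D, Hu. }
  exists x. split; [split; [|split]|].
  - intros i Hi. apply Rnot_lt_le. intros Hlt. destruct (Small (- x i)) as [k Hk]; [lra|].
    specialize (Hx k (u k) i (Hu k)). pose proof (inDelta_le1 n _ i (Du k)).
    unfold Rabs in Hx. destruct (Rcase_abs _) in Hx; lra.
  - intros i Hi. apply (Zero _ 1); [lra|]. intros k. specialize (Hx k (u k) i (Hu k)).
    destruct (Du k) as (_ & Hz & _). rewrite (Hz i Hi), Rminus_0_r in Hx. lra.
  - apply Rminus_diag_uniq. apply (Zero _ (INR (S n))); [apply pos_INR|]. intros k.
    destruct (Du k) as (_ & _ & H1). rewrite <- H1, !psum_sum. apply psum_diff.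
    intros i _. apply Hx, Hu.
  - intros eps He. destruct (Small eps He) as [k Hk]. exists k. intros v j Hv.
    rewrite Rabs_minus_sym. specialize (Hx k v j Hv). lra.
Qed.

Definition locally_in (T : nat -> simplex -> Prop) (n : nat) (s : simplex) : Prop :=
  forall x, inDelta n x -> exists eps, 0 < eps /\
    forall l, length l = S n -> Forall (inDelta n) l ->
      (forall v j, In v l -> Rabs (v j - x j) <= eps) -> T n (along s l).

Lemma exists_uniform {B : Type} (P : nat -> B -> Prop) (l : list B) :
  (forall k k' b, (k <= k')%nat -> P k b -> P k' b) ->
  (forall b, In b l -> exists k, P k b) -> exists k, forall b, In b l -> P k b.
Proof.
  intros Mon. induction l as [|a l IH]; intros H; [exists O; intros b []|].
  destruct (H a (or_introl eq_refl)) as [k Hk].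
  destruct IH as [k' Hk']; [intros b Hb; apply H; right; exact Hb|].
  exists (max k k'). intros b [<-|Hb].
  - apply (Mon k); [lia|exact Hk].
  - apply (Mon k'); [lia|auto].
Qed.

(* In place of a Lebesgue number: if no subdivision of [s] is small, then a nested sequence of
   simplices without small subdivisions shrinks to a point, where [locally_in] is violated. *)
Lemma locally_in_subdivides (T : nat -> simplex -> Prop) : fam T ->
  forall n s, locally_in T n s -> exists k, subdivides T k n s.
Proof.
  intros HT n s Hloc. apply NNPP. intros Hbad.
  set (bad := fun l => length l = S n /\ Forall (inDelta n) l /\
                       forall k, ~ subdivides T k n (along s l)).
  assert (Next : forall l, length l = S n -> Forall (inDelta n) l ->
            (forall k, ~ forall p, In p (sd n l) -> subdivides T k n (along s (snd p))) ->
            exists p, In p (sd n l) /\ bad (snd p)).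
  { intros l L F H. apply NNPP. intros Hno.
    destruct (exists_uniform (fun k p => subdivides T k n (along s (snd p))) (sd n l)) as [k Hk].
    - intros k k' p. apply subdivides_le, HT.
    - intros p Hp. apply NNPP. intros Hp'. apply Hno. exists p. split; [exact Hp|].
      split; [eapply sd_length; eassumption|]. split.
      + eapply sd_convex; [apply bconvex_inDelta|exact L|exact F|exact Hp].
      + intros k Hk. apply Hp'. exists k. exact Hk.
    - exact (H k Hk). }
  assert (Start : exists p, In p (sd n (iota n)) /\ bad (snd p)).
  { apply Next; [apply iota_length|apply iota_inDelta|]. intros k Hk. apply Hbad.
    exists (S k). exact Hk. }
  assert (Step : forall l : {l | bad l}, exists l' : {l | bad l},
            exists p, In p (sd n (proj1_sig l)) /\ proj1_sig l' = snd p).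
  { intros [l (L & F & Hl)]. destruct (Next l L F) as (p & Hp & Bp).
    (* By naturality of [sd], subdividing [along s l] is the same as taking [s] along the
       subdivision of [l]. *)
    - intros k Hk. apply (Hl (S k)). intros p Hp. rewrite along_along.
      rewrite <- (map_aff_iota n l L), sd_map in Hk by (intros; apply aff_bary).
      apply (Hk (fst p, map (aff l) (snd p))). unfold mapb.
      apply (in_map (fun p => (fst p, map (aff l) (snd p)))), Hp.
    - exists (exist _ (snd p) Bp), p. split; [exact Hp|reflexivity]. }
  destruct Start as (p0 & Hp0 & B0).
  set (next := fun l => proj1_sig (constructive_indefinite_description _ (Step l))).
  set (M := fix M k := match k with O => exist bad (snd p0) B0 | S k' => next (M k') end).
  set (L := fun k => proj1_sig (M k)).
  destruct (nested_limit n L) as (x & Dx & Hx).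
  - intros k. apply (proj2_sig (M k)).
  - apply (proj2_sig (M O)).
  - intros k. exact (proj2_sig (constructive_indefinite_description _ (Step (M k)))).
  - destruct (Hloc x Dx) as (eps & He & Hin). destruct (Hx eps He) as [k Hk].
    destruct (proj2_sig (M k)) as (Lk & Fk & Bk).
    apply (Bk O). apply Hin; assumption.
Qed.

Lemma acy_locally_in (T T' : nat -> simplex -> Prop) : fam T -> fam T' ->
  (forall n s, T' n s -> T n s) -> (forall n s, T n s -> locally_in T' n s) -> acy T T'.
Proof.
  intros HT HT' I H n c Hc Bc. destruct Hc as (c' & Hc & E).
  destruct (exists_uniform (fun k p => subdivides T' k n (snd p)) c') as [k Hk].
  - intros k k' p. apply subdivides_le, HT'.
  - intros p Hp. apply locally_in_subdivides; [exact HT'|]. apply H.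
    unfold lit in Hc. rewrite Forall_forall in Hc. apply Hc, Hp.
  - destruct (subdivides_acy T T' HT HT' I k n c' Hc) as (d & e & Hd & He & E').
    + apply Forall_forall. exact Hk.
    + destruct n as [|n]; [exact Logic.I|]. eapply mem_eqv; [exact Bc|].
      apply eqv_bdry. intros g Hg. symmetry. apply E, Hg.
    + exists d, e. split; [exact Hd|]. split; [exact He|]. intros g Hg.
      rewrite (E g Hg). apply E', Hg.
Qed.

End SmallSimplices.

(** * Excision for closed subsets of finite spaces *)

Local Open Scope R_scope.

Section FiniteSpaces.
Context {X : FiniteT0Space}.

Notation simplex := (simplex X).
Notation chain := (chain X).

Definition sing (A : X -> Prop) (n : nat) (s : simplex) : Prop :=
  sing_continuous X n s /\ forall t, inDelta n t -> A (s t).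

Lemma fam_sing A : fam (sing A).
Proof.
  split.
  - intros n s s' E [C H]. split.
    + intros U HU t Ht Ut. rewrite <- E in Ut by assumption.
      destruct (C U HU t Ht Ut) as (eps & He & Hn). exists eps. split; [exact He|].
      intros u Du Hu. rewrite <- E by assumption. auto.
    + intros t Ht. rewrite <- E by assumption. auto.
  - intros n m s w [C H] L F.
    assert (D : forall t, inDelta m t -> inDelta n (aff w t)).
    { intros t Ht. eapply aff_inDelta; eassumption. }
    split; [|intros t Ht; apply H, D, Ht].
    intros U HU t Ht Ut. destruct (C U HU _ (D t Ht) Ut) as (eps & He & Hn).
    pose proof (pos_INR (S m)) as P.
    (* The affine map is Lipschitz with constant [S m] in the maximum norm; the extra 1 makes the
       final estimate strict. *)
    assert (He' : 0 < eps / (INR (S m) + 1)) by (apply Rdiv_lt_0_compat; lra).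
    exists (eps / (INR (S m) + 1)). split; [exact He'|]. intros u Du Hu.
    apply Hn; [apply D, Du|]. intros i _.
    apply (Rle_lt_trans _ (INR (length w) * (eps / (INR (S m) + 1)))).
    + apply aff_cont; [lra| |].
      * intros v Hv j. rewrite Forall_forall in F.
        pose proof (inDelta_le1 n v j (F v Hv)). apply Rabs_le. lra.
      * intros k Hk. apply Rlt_le, Hu. lia.
    + rewrite L. apply (Rmult_lt_reg_r (INR (S m) + 1)); [lra|].
      unfold Rdiv. rewrite <- Rmult_assoc, Rmult_assoc, Rinv_l by lra. nra.
Qed.

Lemma sing_mono (A B : X -> Prop) : (forall x, A x -> B x) ->
  forall n s, sing A n s -> sing B n s.
Proof. intros H n s [C I]. split; auto. Qed.

Lemma sing_inter (A B : X -> Prop) n s :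
  sing A n s -> sing B n s -> sing (fun x => A x /\ B x) n s.
Proof. intros [C HA] [_ HB]. split; auto. Qed.

(** Stated for a family [T] inside [sing Y], because it is applied both to [sing Y] itself and to
    S(A) + S(B). *)
Lemma acy_open_cover (T : nat -> simplex -> Prop) (Y U1 U2 : X -> Prop) : fam T ->
  (forall n s, T n s -> sing Y n s) -> is_open X U1 -> is_open X U2 ->
  (forall y, Y y -> U1 y \/ U2 y) ->
  acy T (fun n s => T n s /\ (sing (fun y => Y y /\ U1 y) n s \/ sing (fun y => Y y /\ U2 y) n s)).
Proof.
  intros HT HY O1 O2 Cov. apply acy_locally_in; [exact HT| |tauto|].
  - apply fam_and; [exact HT|]. apply fam_or; apply fam_sing.
  - intros n s Hs x Dx. pose proof (HY n s Hs) as [C HYs].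
    assert (Loc : forall U, is_open X U -> U (s x) -> exists eps, 0 < eps /\
      forall l, length l = S n -> Forall (inDelta n) l ->
      (forall v j, In v l -> Rabs (v j - x j) <= eps) ->
      T n (along s l) /\ sing (fun y => Y y /\ U y) n (along s l)).
    { intros U HU Ux. destruct (C U HU x Dx Ux) as (eps & He & Hn).
      (* Half of [eps]: nearness of the vertices is a weak inequality, continuity asks for a strict
         one. *)
      exists (eps / 2). split; [lra|]. intros l L F Hl.
      assert (Tl : T n (along s l)) by (apply (fam_along T HT n); assumption).
      split; [exact Tl|]. pose proof (HY n _ Tl) as [Cl Yl]. split; [exact Cl|].
      intros t Dt. split; [apply Yl, Dt|]. apply Hn; [eapply aff_inDelta; eassumption|].
      intros i _. apply (Rle_lt_trans _ (eps / 2)); [|lra].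
      apply (aff_near (x i) (eps / 2) i l n); [exact L|exact Dt|].
      intros v Hv. apply Hl, Hv. }
    destruct (Cov _ (HYs x Dx)) as [Ux|Ux].
    + destruct (Loc U1 O1 Ux) as (eps & He & H). exists eps. split; [exact He|].
      intros l L F Hl. destruct (H l L F Hl). auto.
    + destruct (Loc U2 O2 Ux) as (eps & He & H). exists eps. split; [exact He|].
      intros l L F Hl. destruct (H l L F Hl). auto.
Qed.

(** The apex is vertex 0, so face 0 is the base and the others are cones over faces of the base. At
    [t 0 = 1] the normalisation by [1 - t 0] breaks down and the apex is the value. *)
Definition cone (x : X) (s : simplex) : simplex := fun t =>
  if Req_EM_T (t O) 1 then x else s (fun j => / (1 - t O) * ptail t j).

Lemma cone_inDelta n t : inDelta (S n) t -> t O <> 1 ->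
  inDelta n (fun j => / (1 - t O) * ptail t j).
Proof.
  intros D H. pose proof (inDelta_le1 _ _ O D) as B. destruct D as (H1 & H2 & H3).
  assert (P : 0 < / (1 - t O)) by (apply Rinv_0_lt_compat; lra).
  split; [|split].
  - intros i Hi. apply Rmult_le_pos; [lra|]. apply H1. lia.
  - intros i Hi. unfold ptail. rewrite (H2 (S i)) by lia. apply Rmult_0_r.
  - rewrite psum_sum in *. rewrite psum_scale. cbn [psum] in H3.
    change (ptail t O + psum n (ptail (ptail t))) with (psum (S n) (ptail t)) in H3.
    replace (psum (S n) (ptail t)) with (1 - t O) by lra. apply Rinv_l. lra.
Qed.

Lemma cone_face0 x s : (fun t => cone x s (face 0 t)) = s.
Proof.
  apply functional_extensionality. intros t. unfold cone.
  rewrite ptail_face0. unfold face at 1. cbn. destruct (Req_EM_T 0 1) as [E|_]; [lra|].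
  f_equal. apply functional_extensionality. intros j. unfold face. cbn.
  rewrite Rminus_0_r, Rinv_1. lra.
Qed.

Lemma cone_faceS x s i :
  (fun t => cone x s (face (S i) t)) = cone x (fun t => s (face i t)).
Proof.
  apply functional_extensionality. intros t. unfold cone.
  rewrite ptail_face, face_scale. unfold face at 1. cbn.
  destruct (Req_EM_T (t O) 1); reflexivity.
Qed.

Lemma agree_cone n x s s' : agree X n s s' -> agree X (S n) (cone x s) (cone x s').
Proof.
  intros H t Dt. unfold cone. destruct (Req_EM_T (t O) 1) as [E|E]; [reflexivity|].
  apply H, cone_inDelta; assumption.
Qed.

(** An open set containing [x] contains all of [A], so its preimage is the whole simplex. Any other
    open set misses the apex, and away from the apex vertex the cone is [s] after a continuous
    normalisation. *)
Lemma sing_cone (A : X -> Prop) (x : X) : A x ->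
  (forall U y, is_open X U -> U x -> A y -> U y) ->
  forall n s, sing A n s -> sing A (S n) (cone x s).
Proof.
  intros Ax Hmin n s [C HA].
  assert (HAc : forall t, inDelta (S n) t -> A (cone x s t)).
  { intros t Dt. unfold cone. destruct (Req_EM_T (t O) 1) as [E|E]; [exact Ax|].
    apply HA, cone_inDelta; assumption. }
  split; [|exact HAc]. intros U HU t Dt Ut.
  destruct (classic (U x)) as [Ux|Ux].
  - exists 1. split; [lra|]. intros u Du _. apply (Hmin U _ HU Ux), HAc, Du.
  - unfold cone in Ut. destruct (Req_EM_T (t O) 1) as [E|E]; [contradiction|].
    destruct (C U HU _ (cone_inDelta n t Dt E) Ut) as (eps & He & Hn).
    pose proof (inDelta_le1 _ _ O Dt) as B.
    set (a := 1 - t O) in *. assert (Ha : 0 < a) by (unfold a; lra).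
    (* For [|u - t| < del] we have [1 - u_0 >= a/2], so the normalised coordinates differ by
       at most [2 del / (a * (a/2))]. *)
    set (del := Rmin (a / 2) (eps * a * a / 8)).
    assert (Hd1 : del <= a / 2) by apply Rmin_l.
    assert (Hd2 : del <= eps * a * a / 8) by apply Rmin_r.
    assert (Hdel : 0 < del).
    { apply Rmin_pos; [lra|]. assert (0 < eps * a) by nra. assert (0 < eps * a * a) by nra. lra. }
    exists del. split; [exact Hdel|]. intros u Du Hu.
    assert (H0 : Rabs (u O - t O) < del) by (apply Hu; lia).
    assert (Hb : a / 2 <= 1 - u O).
    { unfold a in *. unfold Rabs in H0. destruct (Rcase_abs _) in H0; lra. }
    unfold cone. destruct (Req_EM_T (u O) 1) as [E'|E']; [lra|].
    apply Hn; [apply cone_inDelta; assumption|]. intros i Hi.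
    assert (Hi' : Rabs (u (S i) - t (S i)) < del) by (apply Hu; lia).
    set (b := 1 - u O) in *. unfold ptail.
    replace (/ b * u (S i) - / a * t (S i))
      with (/ (a * b) * (a * (u (S i) - t (S i)) + t (S i) * (u O - t O)))
      by (unfold a, b in *; field; lra).
    assert (Hab : 0 < a * b) by nra.
    rewrite Rabs_mult, (Rabs_right (/ (a * b)))
      by (apply Rle_ge, Rlt_le, Rinv_0_lt_compat; exact Hab).
    pose proof (inDelta_le1 _ _ (S i) Dt) as Bi.
    assert (N : Rabs (a * (u (S i) - t (S i)) + t (S i) * (u O - t O)) <= 2 * del).
    { eapply Rle_trans; [apply Rabs_triang|]. rewrite !Rabs_mult.
      rewrite (Rabs_right a), (Rabs_right (t (S i))) by lra.
      pose proof (Rabs_pos (u (S i) - t (S i))). pose proof (Rabs_pos (u O - t O)).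
      assert (a <= 1) by (unfold a; lra). nra. }
    apply (Rmult_lt_reg_l (a * b)); [exact Hab|].
    rewrite <- Rmult_assoc, Rinv_r, Rmult_1_l by lra.
    assert (a * (a / 2) * eps <= a * b * eps).
    { apply Rmult_le_compat_r; [lra|]. apply Rmult_le_compat_l; lra. }
    assert (0 < eps * a) by nra. assert (0 < eps * a * a) by nra. lra.
Qed.

Lemma sing_const (A : X -> Prop) (x : X) n : A x -> sing A n (fun _ => x).
Proof.
  intros Ax. split; [|auto]. intros U _ t _ Ux. exists 1. split; [lra|]. auto.
Qed.

Local Open Scope Z_scope.

(* Coning with apex [x] contracts both complexes at once. *)
Lemma acy_cone (T T' : nat -> simplex -> Prop) (x : X) :
  (forall n s, T n s -> T (S n) (cone x s)) -> (forall n s, T' n s -> T' (S n) (cone x s)) ->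
  T' O (fun _ => x) -> acy T T'.
Proof.
  intros C C' Cx n c (c' & Hc & E) Bc.
  assert (Mc : forall T n c, (forall n s, T n s -> T (S n) (cone x s)) -> lit T n c ->
               lit T (S n) (mapb (cone x) c)).
  { intros T0 k d H Hd. apply Forall_forall. intros p Hp. apply in_mapb in Hp.
    destruct Hp as (q & Hq & ->). apply H. unfold lit in Hd. rewrite Forall_forall in Hd. auto. }
  assert (D : forall m g s, dg m g (cone x s)
    = g s - asum (S m) (fun i => g (cone x (fun t => s (face i t))))).
  { intros m g s. unfold dg. cbn [asum]. rewrite cone_face0.
    f_equal. rewrite cone_faceS. f_equal. apply asum_ext. intros i _.
    rewrite cone_faceS. reflexivity. }
  exists (mapb (cone x) c'). destruct n as [|n].
  (* In degree 0 the boundary of the cone over [s] is [s] minus the constant simplex at [x], which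
     lies in [T']. *)
  - exists (mapb (fun _ => (fun _ => x) : simplex) c').
    split; [apply mem_lit, Mc; assumption|]. split.
    + apply mem_lit, Forall_forall. intros p Hp. apply in_mapb in Hp.
      destruct Hp as (q & _ & ->). exact Cx.
    + intros g Hg. rewrite (E g Hg), ev_app, ev_bdry, !ev_mapb, <- ev_add.
      apply ev_ext. intros s. rewrite D. cbn [asum].
      rewrite (Hg (cone x (fun t => s (face 0 t))) (fun _ => x)); [lia|].
      intros t (_ & _ & Ht). simpl in Ht. unfold cone.
      destruct (Req_EM_T (t O) 1); [reflexivity|contradiction].
  (* In higher degrees the boundary of the cone over [c] is [c] minus the cone over ∂c; the latter
     is represented in [T'] by the cone over [e]. *)
  - destruct Bc as (e & He & Ee). exists (mapb (cone x) e).
    split; [apply mem_lit, Mc; assumption|]. split; [apply mem_lit, Mc; assumption|].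
    intros g Hg. rewrite (E g Hg), ev_app, ev_bdry, !ev_mapb.
    rewrite (ev_ext _ _ _ (D (S n) g)), ev_sub.
    assert (R : resp n (fun s => g (cone x s))).
    { intros s s' H. apply Hg, agree_cone, H. }
    specialize (Ee _ R). rewrite ev_bdry in Ee.
    pose proof (E _ (resp_dg n _ R)) as E'. rewrite <- Ee, E'. unfold dg. lia.
Qed.

(** The specialisation order, oriented so that closed sets are the down-sets and the smallest open
    neighbourhood of a point is its up-set. *)
Definition below (x y : X) : Prop := cl X (fun z => z = y) x.

Lemma below_open x y : below x y <-> forall U, is_open X U -> U x -> U y.
Proof.
  split.
  - intros H U HU Ux. apply NNPP. intros Uy. apply (H (fun z => ~ U z)).
    + unfold is_closed. eapply open_ext; [|exact HU]. intros z. cbv beta. tauto.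
    + intros z ->. exact Uy.
    + exact Ux.
  - intros H C HC Cy. apply NNPP. intros Cx. apply (H _ HC Cx). apply Cy. reflexivity.
Qed.

Lemma below_refl x : below x x.
Proof. apply below_open. auto. Qed.

Lemma below_trans x y z : below x y -> below y z -> below x z.
Proof. rewrite !below_open. intros H H1 U HU Ux. apply H1, H; assumption. Qed.

Lemma below_antisym x y : below x y -> below y x -> x = y.
Proof.
  rewrite !below_open. intros H H'. apply NNPP. intros Ne.
  destruct (T0_ax X x y Ne) as (U & HU & N). apply N. split; [apply (H U HU)|apply (H' U HU)].
Qed.

Lemma closed_below (C : X -> Prop) x y : is_closed X C -> C y -> below x y -> C x.
Proof. intros HC Cy H. apply (H C HC). intros z ->. exact Cy. Qed.

(** By finiteness: intersect, for each point not above [x], an open set that contains [x] and misses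
    that point. *)
Lemma minimal_open (x : X) : exists U, is_open X U /\ forall y, U y <-> below x y.
Proof.
  destruct (finite_pts X) as [l Hl].
  assert (H : forall l, exists U, is_open X U /\ U x /\ forall y, In y l -> ~ below x y -> ~ U y).
  { clear. induction l as [|a l (U & HU & Ux & H)].
    - exists (fun _ => True). split; [apply open_full|]. split; [exact Logic.I|]. intros y [].
    - destruct (classic (below x a)) as [La|La].
      + exists U. split; [exact HU|]. split; [exact Ux|]. intros y [<-|Hy] Ny; auto.
      + rewrite below_open in La. apply not_all_ex_not in La. destruct La as [W La].
        exists (fun z => U z /\ W z). split; [apply open_inter; tauto|]. split; [tauto|].
        intros y [<-|Hy] Ny; [tauto|]. intros [Uy _]. exact (H y Hy Ny Uy). }
  destruct (H l) as (U & HU & Ux & H'). exists U. split; [exact HU|]. intros y. split.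
  - intros Uy. apply NNPP. intros Ny. exact (H' y (Hl y) Ny Uy).
  - intros Hy. rewrite below_open in Hy. apply (Hy U HU Ux).
Qed.

Lemma downset_closed (C : X -> Prop) : (forall x y, below x y -> C y -> C x) -> is_closed X C.
Proof.
  intros H. unfold is_closed.
  apply (open_ext X (fun z => exists U, (is_open X U /\ forall y, U y -> ~ C y) /\ U z)).
  - intros z. split.
    + intros (U & (_ & HU) & Uz). auto.
    + intros Cz. destruct (minimal_open z) as (U & HU & Hz). exists U.
      split; [split; [exact HU|]|apply Hz, below_refl]. intros y Uy Cy. apply Cz.
      apply (H z y); [apply Hz, Uy|exact Cy].
  - apply open_union. tauto.
Qed.

Lemma cl_below (A : X -> Prop) x : cl X A x <-> exists y, A y /\ below x y.
Proof.
  split.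
  - intros H. apply (H (fun x => exists y, A y /\ below x y)).
    + apply downset_closed. intros u v L (y & Ay & Ly). exists y. split; [exact Ay|].
      eapply below_trans; eassumption.
    + intros y Ay. exists y. split; [exact Ay|apply below_refl].
  - intros (y & Ay & L) C HC HA. apply (closed_below C x y HC); auto.
Qed.

Lemma closed_cl (A : X -> Prop) : is_closed X (cl X A).
Proof.
  apply downset_closed. intros u v L Hv. apply cl_below in Hv. apply cl_below.
  destruct Hv as (w & Hw & L'). exists w. split; [exact Hw|]. eapply below_trans; eassumption.
Qed.

(** If [y0] is not terminal, restrict to the points strictly beyond it; [y0] drops out, and
    terminality there implies terminality in [Y]. This serves for minimal points and for terminal
    strongly connected components. *)
Lemma exists_terminal (R : X -> X -> Prop) (Y : X -> Prop) :
  (forall x y z, R x y -> R y z -> R x z) -> (exists y, Y y) ->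
  exists x, Y x /\ forall y, Y y -> R x y -> R y x.
Proof.
  intros Tr. destruct (finite_pts X) as [l Hl].
  cut (forall (N : nat) (l : list X) (Y : X -> Prop), (length l <= N)%nat ->
    (forall y, Y y -> In y l) -> (exists y, Y y) ->
    exists x, Y x /\ forall y, Y y -> R x y -> R y x).
  { intros H. apply (H (length l) l); auto. }
  clear Y l Hl. induction N as [|N IH]; intros l Y HN Hl [y0 Y0].
  - specialize (Hl y0 Y0). destruct l; [destruct Hl|simpl in HN; lia].
  - destruct (classic (exists z, Y z /\ R y0 z /\ ~ R z y0)) as [Hz|Hz].
    + destruct (in_split _ _ (Hl y0 Y0)) as (l1 & l2 & ->).
      destruct (IH (l1 ++ l2) (fun z => Y z /\ R y0 z /\ ~ R z y0)) as (x & (Yx & Lx & Nx) & Hx).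
      * rewrite length_app in *. simpl in HN. lia.
      * intros z (Yz & Rz & Nz). specialize (Hl z Yz). apply in_app_or in Hl. apply in_or_app.
        destruct Hl as [Hl|[Hl|Hl]]; auto. subst z. contradiction.
      * exact Hz.
      * exists x. split; [exact Yx|]. intros y Yy Ly. apply Hx; [|exact Ly].
        split; [exact Yy|]. split; [eapply Tr; eassumption|].
        intros Ry. apply Nx. eapply Tr; eassumption.
    + exists y0. split; [exact Y0|]. intros y Yy Ly. apply NNPP. intros N0. apply Hz. eauto.
Qed.

Lemma exists_minimal (Y : X -> Prop) : (exists y, Y y) ->
  exists x, Y x /\ forall y, Y y -> below y x -> y = x.
Proof.
  intros Ne. destruct (exists_terminal (fun x y => below y x) Y) as (x & Yx & Hx).
  - intros x y z H H'. eapply below_trans; eassumption.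
  - exact Ne.
  - exists x. split; [exact Yx|]. intros y Yy L. apply below_antisym; auto.
Qed.

(* Excision for relatively closed sets: induction on the number of points, removing a minimal
   point [x].  The open sets [Y \ {x}] and [{y in Y | x <= y}] cover [Y], and the latter is a cone
   with apex [x]. *)
Lemma acy_down_union : forall (N : nat) (l : list X) (Y A B : X -> Prop), (length l <= N)%nat ->
  (forall y, Y y -> In y l) -> (forall y, Y y <-> A y \/ B y) ->
  (forall x y, Y x -> below x y -> A y -> A x) -> (forall x y, Y x -> below x y -> B y -> B x) ->
  acy (sing Y) (fun n s => sing A n s \/ sing B n s).
Proof.
  induction N as [|N IH]; intros l Y A B HN Hl HY DA DB.
  { apply acy_refl. intros n s Hs. left. revert Hs. apply sing_mono. intros y Yy.
    specialize (Hl y Yy). destruct l; [destruct Hl|simpl in HN; lia]. }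
  destruct (classic (exists y, Y y)) as [Ne|Ne].
  2: { apply acy_refl. intros n s Hs. left. revert Hs. apply sing_mono. intros y Yy.
       exfalso. apply Ne. eauto. }
  destruct (exists_minimal Y Ne) as (x & Yx & Hx).
  destruct (minimal_open x) as (U2 & O2 & HU2).
  (* By minimality of [x] this agrees on [Y] with the complement of [x], and it is open in [X]. *)
  set (U1 := fun y => ~ below y x).
  assert (O1 : is_open X U1).
  { apply (downset_closed (fun y => below y x)). intros u v L L'. eapply below_trans; eassumption. }
  assert (Cov : forall y, Y y -> U1 y \/ U2 y).
  { intros y Yy. destruct (classic (below y x)) as [L|L]; [right|left; exact L].
    rewrite (Hx y Yy L). apply HU2, below_refl. }
  set (T := fun n s => sing A n s \/ sing B n s).
  assert (HT : fam T) by (apply fam_or; apply fam_sing).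
  assert (TY : forall n s, T n s -> sing Y n s).
  { intros n s [H|H]; revert H; apply sing_mono; intros y Hy; apply HY; tauto. }
  set (R := fun (U : X -> Prop) n s =>
    sing (fun y => A y /\ U y) n s \/ sing (fun y => B y /\ U y) n s).
  assert (HR : forall U, fam (R U)) by (intros U; apply fam_or; apply fam_sing).
  assert (RY : forall U n s, R U n s -> sing (fun y => Y y /\ U y) n s).
  { intros U n s [H|H]; revert H; apply sing_mono; intros y Hy; split; try apply HY; tauto. }
  assert (Sub : forall U : X -> Prop, ~ U x ->
    acy (sing (fun y => Y y /\ U y)) (R U)).
  { intros U Ux. destruct (in_split _ _ (Hl x Yx)) as (l1 & l2 & E).
    apply (IH (l1 ++ l2)).
    - rewrite E, length_app in HN. rewrite length_app. simpl in HN. lia.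
    - intros z [Yz Uz]. specialize (Hl z Yz). rewrite E in Hl. apply in_app_or in Hl.
      apply in_or_app. destruct Hl as [Hl|[Hl|Hl]]; auto. congruence.
    - intros y. specialize (HY y). tauto.
    - intros u v [Yu Uu] L [Av _]. split; [eapply DA; eassumption|exact Uu].
    - intros u v [Yu Uu] L [Bv _]. split; [eapply DB; eassumption|exact Uu]. }
  assert (Mono : forall (U W : X -> Prop) n s, (forall y, U y -> W y) -> R U n s -> R W n s).
  { intros U W n s I [H|H]; [left|right]; revert H; apply sing_mono; intros y [? ?]; auto. }
  assert (Meet : forall (U W : X -> Prop) n s, sing (fun y => Y y /\ U y) n s -> R W n s ->
                 R (fun y => U y /\ W y) n s).
  { intros U W n s H [H'|H']; [left|right]; pose proof (sing_inter _ _ _ _ H H') as I;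
      revert I; apply sing_mono; tauto. }
  assert (A1 : acy (sing (fun y => Y y /\ U1 y)) (R U1)).
  { apply Sub. intros H. apply H, below_refl. }
  assert (A12 : acy (sing (fun y => Y y /\ (U1 y /\ U2 y))) (R (fun y => U1 y /\ U2 y))).
  { apply Sub. intros [H _]. apply H, below_refl. }
  assert (A2 : acy (sing (fun y => Y y /\ U2 y)) (R U2)).
  { assert (Up : forall (P : X -> Prop) U y, is_open X U -> U x -> P y /\ U2 y -> U y).
    { intros P U y HU Ux [_ Uy]. apply HU2 in Uy. rewrite below_open in Uy. apply (Uy U HU Ux). }
    assert (U2x : U2 x) by (apply HU2, below_refl).
    (* If [x] lies in both sets, all complexes are cones. If it misses one of them, no point of that
       set is above [x], so [Y] meets [U2] only in points of the other. *)
    destruct (classic (A x)) as [Ax|Ax]; [destruct (classic (B x)) as [Bx|Bx]|].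
    - apply (acy_cone _ _ x).
      + apply sing_cone; [tauto|apply Up].
      + intros n s [H|H]; [left|right]; (apply sing_cone; [tauto|apply Up|exact H]).
      + left. apply sing_const. tauto.
    - apply acy_refl. intros n s H. left. revert H. apply sing_mono. intros y [Yy Uy].
      split; [|exact Uy]. destruct (proj1 (HY y) Yy) as [H|H]; [exact H|].
      exfalso. apply Bx, (DB x y); [exact Yx|apply HU2, Uy|exact H].
    - apply acy_refl. intros n s H. right. revert H. apply sing_mono. intros y [Yy Uy].
      split; [|exact Uy]. destruct (proj1 (HY y) Yy) as [H|H]; [|exact H].
      exfalso. apply Ax, (DA x y); [exact Yx|apply HU2, Uy|exact H]. }
  (* From [S12] over [S1] to [S0] the two summands S(Y ∩ U) are replaced by [R U] one at a time,
     [U2] before [U1]. *)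
  set (S1 := fun n s => sing (fun y => Y y /\ U1 y) n s \/ R U2 n s).
  set (S12 := fun n s => sing (fun y => Y y /\ U1 y) n s \/ sing (fun y => Y y /\ U2 y) n s).
  set (S0 := fun n s => R U1 n s \/ R U2 n s).
  assert (B1 : acy S1 S0).
  { apply (acy_excision _ (sing (fun y => Y y /\ U1 y)) _ (R U1)).
    - apply fam_sing.
    - apply fam_or; apply HR.
    - intros n s [H|H]; [left|right; right]; exact H.
    - intros n s H. left. exact H.
    - intros n s H [H'|H']; [exact H'|].
      apply (Mono (fun y => U1 y /\ U2 y)); [tauto|]. apply Meet; assumption.
    - intros n s H. left. exact H.
    - exact A1. }
  assert (B2 : acy S12 S1).
  (* Besides [R U2], the family [S1] contains the simplices of Y ∩ U1 ∩ U2, so S(Y ∩ U2) has to be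
     compared with the larger family [M]. The triple of [R U2], [M] and S(Y ∩ U2) reduces this to
     [A2] and [A12]. *)
  { set (M := fun n s => sing (fun y => Y y /\ (U1 y /\ U2 y)) n s \/ R U2 n s).
    apply (acy_excision _ (sing (fun y => Y y /\ U2 y)) _ M).
    - apply fam_sing.
    - apply fam_or; [apply fam_sing|apply HR].
    - intros n s [H|H]; [right; left|left]; exact H.
    - intros n s H. right. exact H.
    - intros n s H [H'|H']; [left|right; exact H'].
      pose proof (sing_inter _ _ _ _ H H') as I. revert I. apply sing_mono. tauto.
    - intros n s [H|H]; [left|right; exact H]. revert H. apply sing_mono. tauto.
    - apply (acy_left _ _ (R U2)); [| |exact A2|].
      + intros n s [H|H]; [revert H; apply sing_mono; tauto|apply RY, H].
      + intros n s H. right. exact H.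
      + apply (acy_excision _ (sing (fun y => Y y /\ (U1 y /\ U2 y))) _
                 (R (fun y => U1 y /\ U2 y))).
        * apply fam_sing.
        * apply HR.
        * intros n s H. exact H.
        * intros n s H. left. exact H.
        * intros n s H H'. apply (Mono (fun y => (U1 y /\ U2 y) /\ U2 y)); [tauto|].
          apply Meet; assumption.
        * intros n s H. revert H. apply Mono. tauto.
        * exact A12. }
  (* S(Y) and [T] are both acyclic modulo [S0], by subdivision and, for S(Y), the two replacements;
     the triple then gives S(Y) modulo [T]. *)
  apply (acy_left _ _ S0).
  - exact TY.
  - intros n s [[H|H]|[H|H]]; [left|right|left|right]; revert H; apply sing_mono; tauto.
  - apply (acy_trans _ S12).
    + intros n s [H|H]; revert H; apply sing_mono; tauto.
    + intros n s [H|H]; [left|right]; apply RY; exact H.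
    + apply (acy_iff (sing Y) (fun n s => sing Y n s /\ S12 n s)).
      * tauto.
      * intros n s. split; [tauto|]. intros [H|H];
          (split; [revert H; apply sing_mono; tauto|]); [left|right]; exact H.
      * apply acy_open_cover; auto. apply fam_sing.
    + apply (acy_trans _ S1).
      * intros n s [H|H]; [left; exact H|right; apply RY; exact H].
      * intros n s [H|H]; [left; apply RY; exact H|right; exact H].
      * exact B2.
      * exact B1.
  - apply (acy_iff T (fun n s => T n s /\ S12 n s)).
    + tauto.
    + intros n s. split.
      * intros [[H|H] [H'|H']]; [left; left|right; left|left; right|right; right];
          pose proof (sing_inter _ _ _ _ H H') as I; revert I; apply sing_mono; tauto.
      * intros H. split.
        -- destruct H as [[H|H]|[H|H]]; [left|right|left|right]; revert H;
             apply sing_mono; tauto.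
        -- destruct H as [H|H]; [left|right]; apply RY; exact H.
    + apply acy_open_cover; auto.
Qed.

Theorem acy_closed_union (A B : X -> Prop) : is_closed X A -> is_closed X B ->
  acy (sing (fun y => A y \/ B y)) (fun n s => sing A n s \/ sing B n s).
Proof.
  intros HA HB. destruct (finite_pts X) as [l Hl].
  apply (acy_down_union (length l) l); auto; [tauto| |].
  - intros x y _ L Ay. eapply closed_below; eassumption.
  - intros x y _ L By. eapply closed_below; eassumption.
Qed.

End FiniteSpaces.

(** * Isomorphisms in homology *)

Local Open Scope Z_scope.

Section Isomorphisms.
Context {X : FiniteT0Space}.

Notation simplex := (simplex X).
Notation chain := (chain X).

Lemma supp_mem n (A : X -> Prop) c : supp X n A c <-> mem (sing A) n c.
Proof.
  split.
  - intros H. exists (select (sing A n) c). split.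
    + eapply Forall_impl; [|apply (lit_select (fun _ _ => True) n (sing A n) c)].
      * intros p [_ Hp]. exact Hp.
      * apply Forall_forall. intros; exact I.
    + intros g Hg. rewrite (ev_split (sing A n) g c).
      cut (ev g (select (fun s => ~ sing A n s) c) = 0); [lia|]. rewrite ev_select.
      apply (ev_coeff_zero n).
      * apply resp_mul; [exact Hg|]. apply resp_indicator. intros s s' E N N'. apply N.
        apply (fam_ext _ (fam_sing A) n s'); [apply agree_sym, E|exact N'].
      * intros s Hs. apply NNPP. intros Hc. apply Hs.
        destruct (excluded_middle_informative (~ sing A n s)) as [N|N]; [|lia].
        exfalso. apply N. exact (H s Hc).
  - intros (c' & Hc & E) s Hs. apply eqc_eqv in E. rewrite (E s) in Hs.
    change (sing A n s). clear E.
    induction c' as [|p c' IH]; [exfalso; apply Hs; reflexivity|].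
    inversion_clear Hc. simpl in Hs.
    destruct (excluded_middle_informative (agree X n (snd p) s)) as [e|e].
    + apply (fam_ext _ (fam_sing A) n (snd p)); assumption.
    + apply IH; [assumption|]. intros E. apply Hs. rewrite E. reflexivity.
Qed.

Lemma rcycle_mem n (A B : X -> Prop) c :
  rcycle X n A B c <-> mem (sing A) n c /\ bmem (sing B) n c.
Proof.
  unfold rcycle. rewrite !supp_mem. destruct n as [|n].
  - split; [intros [H _]; split; [exact H|exact I]|]. intros [H _]. split; [exact H|apply mem_nil].
  - cbn [bmem]. replace (S n - 1)%nat with n by lia. tauto.
Qed.

Lemma rbound_rb n (A B : X -> Prop) c : rbound X n A B c <-> rb (sing A) (sing B) n c.
Proof.
  split; intros (d & e & H).
  - exists d, e. rewrite <- !supp_mem, <- eqc_eqv. exact H.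
  - exists d, e. rewrite !supp_mem, eqc_eqv. exact H.
Qed.

Lemma acy_H_trivial (A B : X -> Prop) :
  (forall n, H_trivial X n A B) -> acy (sing A) (sing B).
Proof. intros H n c Hc Bc. apply rbound_rb, H, rcycle_mem. split; assumption. Qed.

Lemma rcycle_app n (A B : X -> Prop) c d :
  rcycle X n A B c -> rcycle X n A B d -> rcycle X n A B (c ++ d).
Proof.
  rewrite !rcycle_mem. intros [Hc Bc] [Hd Bd]. split; [apply mem_app; assumption|].
  destruct n as [|n]; [exact I|]. apply (mem_eqv _ _ (bdry X (S n) c ++ bdry X (S n) d)).
  - apply mem_app; assumption.
  - chain_eq.
Qed.

Lemma rb_eqv T T' n (c c' : chain) : rb T T' n c -> eqv n c' c -> rb T T' n c'.
Proof.
  intros (d & e & Hd & He & E) E'. exists d, e. split; [exact Hd|]. split; [exact He|].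
  intros g Hg. rewrite (E' g Hg). apply E, Hg.
Qed.

Lemma rb_app T T' n (c c' : chain) : rb T T' n c -> rb T T' n c' -> rb T T' n (c ++ c').
Proof.
  intros (d & e & Hd & He & E) (d' & e' & Hd' & He' & E'). exists (d ++ d'), (e ++ e').
  split; [apply mem_app; assumption|]. split; [apply mem_app; assumption|]. chain_eq.
Qed.

Lemma rb_neg T T' n (c : chain) : rb T T' n c -> rb T T' n (negc X c).
Proof.
  intros (d & e & Hd & He & E). exists (negc X d), (negc X e).
  split; [apply mem_neg; assumption|]. split; [apply mem_neg; assumption|]. chain_eq.
Qed.

Lemma homeq_refl n (A B : X -> Prop) c : homeq X n A B c c.
Proof.
  apply rbound_rb. exists [], []. split; [apply mem_nil|]. split; [apply mem_nil|].
  intros g _. rewrite !ev_app, ev_negc, ev_bdry. cbn [ev fold_right]. lia.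
Qed.

Lemma homeq_sym n (A B : X -> Prop) c d : homeq X n A B c d -> homeq X n A B d c.
Proof.
  unfold homeq. rewrite !rbound_rb. intros H. apply rb_neg in H.
  eapply rb_eqv; [exact H|]. chain_eq.
Qed.

Lemma homeq_trans n (A B : X -> Prop) c d e :
  homeq X n A B c d -> homeq X n A B d e -> homeq X n A B c e.
Proof.
  unfold homeq. rewrite !rbound_rb. intros H H'. pose proof (rb_app _ _ _ _ _ H H') as H0.
  eapply rb_eqv; [exact H0|]. chain_eq.
Qed.

Lemma homeq_app n (A B : X -> Prop) c c' d d' :
  homeq X n A B c c' -> homeq X n A B d d' -> homeq X n A B (c ++ d) (c' ++ d').
Proof.
  unfold homeq. rewrite !rbound_rb. intros H H'. pose proof (rb_app _ _ _ _ _ H H') as H0.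
  eapply rb_eqv; [exact H0|]. chain_eq.
Qed.

(* Isomorphisms as relations between cycles: in this form they are visibly symmetric and
   transitive. *)
Definition rel_iso (n : nat) (A B A' B' : X -> Prop) : Prop :=
  exists rho : chain -> chain -> Prop,
    (forall c c', rho c c' -> rcycle X n A B c /\ rcycle X n A' B' c') /\
    (forall c, rcycle X n A B c -> exists c', rho c c') /\
    (forall c', rcycle X n A' B' c' -> exists c, rho c c') /\
    (forall c c' d d', rho c c' -> rho d d' -> rho (c ++ d) (c' ++ d')) /\
    (forall c c' d d', rho c c' -> rho d d' -> (homeq X n A B c d <-> homeq X n A' B' c' d')).

Lemma rel_iso_sym n A B A' B' : rel_iso n A B A' B' -> rel_iso n A' B' A B.
Proof.
  intros (rho & H1 & H2 & H3 & H4 & H5). exists (fun c c' => rho c' c).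
  split; [|split; [|split; [|split]]]; auto.
  - intros c c' H. apply H1 in H. tauto.
  - intros c c' d d' H H'. symmetry. apply H5; assumption.
Qed.

Lemma rel_iso_trans n A B A' B' A'' B'' :
  rel_iso n A B A' B' -> rel_iso n A' B' A'' B'' -> rel_iso n A B A'' B''.
Proof.
  intros (r & H1 & H2 & H3 & H4 & H5) (r' & H1' & H2' & H3' & H4' & H5').
  exists (fun c e => exists d, r c d /\ r' d e). split; [|split; [|split; [|split]]].
  - intros c e (d & H & H'). split; [apply (H1 _ _ H)|apply (H1' _ _ H')].
  - intros c Hc. destruct (H2 c Hc) as [d Hd]. destruct (H2' d) as [e He]; [apply (H1 _ _ Hd)|].
    exists e, d. auto.
  - intros e Hc. destruct (H3' e Hc) as [d Hd]. destruct (H3 d) as [c He]; [apply (H1' _ _ Hd)|].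
    exists c, d. auto.
  - intros c e c1 e1 (d & H & H') (d1 & K & K'). exists (d ++ d1). auto.
  - intros c e c1 e1 (d & H & H') (d1 & K & K'). rewrite (H5 c d c1 d1) by assumption.
    apply H5'; assumption.
Qed.

Lemma rel_iso_H_iso n A B A' B' : rel_iso n A B A' B' -> H_iso X n A B A' B'.
Proof.
  intros (rho & H1 & H2 & H3 & H4 & H5).
  (* Here [[]] only witnesses that chains exist; at a cycle the chosen chain is related to it. *)
  exists (fun c => epsilon (inhabits []) (rho c)).
  set (f := fun c => epsilon (inhabits []) (rho c)).
  assert (Hf : forall c, rcycle X n A B c -> rho c (f c)).
  { intros c Hc. apply epsilon_spec. auto. }
  split; [|split; [|split; [|split]]].
  - intros c Hc. apply (H1 _ _ (Hf c Hc)).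
  - intros c c' Hc Hc'. apply H5; auto.
  - intros c c' Hc Hc'. apply (H5 (c ++ c') (f (c ++ c')) (c ++ c') (f c ++ f c')).
    + apply Hf, rcycle_app; assumption.
    + apply H4; auto.
    + apply homeq_refl.
  - intros c c' Hc Hc'. apply H5; auto.
  - intros c' Hc'. destruct (H3 c' Hc') as [c Hc]. exists c.
    assert (Cc : rcycle X n A B c) by apply (H1 _ _ Hc). split; [exact Cc|].
    apply (H5 c (f c) c c'); [auto|exact Hc|apply homeq_refl].
Qed.

(** H(A, B) is H(A, A ∩ B') by the second vanishing. The quotient of S(A) by S(A ∩ B') is that of
    S(A) + S(B') by S(B'), and the first vanishing compares this with H(A', B'). *)
Lemma rel_iso_inclusion (A B A' B' : X -> Prop) :
  (forall x, A x -> A' x) -> (forall x, B x -> A x) -> (forall x, B x -> B' x) ->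
  (forall x, B' x -> A' x) ->
  acy (sing A') (fun n s => sing A n s \/ sing B' n s) ->
  acy (sing (fun x => A x /\ B' x)) (sing B) ->
  forall n, rel_iso n A B A' B'.
Proof.
  intros IA IBA IB IBA' Hacy Hacy' n.
  assert (Inter : forall k c, mem (sing A) k c -> mem (sing B') k c ->
            mem (sing (fun x => A x /\ B' x)) k c).
  { intros k c H H'. eapply mem_mono; [|apply (mem_and _ _ _ _ (fam_sing A) H H')].
    intros m s [Hs Hs']. apply sing_inter; assumption. }
  assert (Inc : forall c, rcycle X n A B c -> rcycle X n A' B' c).
  { intros c. rewrite !rcycle_mem. intros [H H']. split.
    - eapply mem_mono; [|exact H]. apply sing_mono, IA.
    - eapply bmem_mono; [|exact H']. apply sing_mono, IB. }
  assert (Fwd : forall c d, homeq X n A B c d -> homeq X n A' B' c d).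
  { intros c d. unfold homeq. rewrite !rbound_rb. intros (x & y & Hx & Hy & E).
    exists x, y. split; [|split; [|exact E]].
    - eapply mem_mono; [|exact Hx]. apply sing_mono, IA.
    - eapply mem_mono; [|exact Hy]. apply sing_mono, IB. }
  (* The bounding chain [d] in [A'] is changed by a boundary into [y1 + y2] with [y1] in [A] and
     [y2] in [B']. Then [c - ∂y1] lies in both [A] and [B'], where the second vanishing applies. *)
  assert (Inj : forall c, mem (sing A) n c -> bmem (sing B) n c ->
            rb (sing A') (sing B') n c -> rb (sing A) (sing B) n c).
  { intros c Hc Bc (d & e & Hd & He & E).
    destruct (Hacy (S n) d Hd) as (x & y & Hx & Hy & Ed).
    { cbn [bmem]. apply (mem_eqv _ _ (c ++ negc X e)).
      - apply mem_app; [|apply mem_neg].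
        + eapply mem_mono; [|exact Hc]. tauto.
        + eapply mem_mono; [|exact He]. tauto.
      - chain_eq. }
    destruct (mem_or _ _ _ _ Hy) as (y1 & y2 & Hy1 & Hy2 & Ey).
    assert (E1 : eqv n c ((bdry X (S n) y1 ++ bdry X (S n) y2) ++ e)) by chain_eq.
    destruct (Hacy' n (c ++ negc X (bdry X (S n) y1))) as (z & w & Hz & Hw & Ez).
    { apply Inter.
      - apply mem_app; [exact Hc|]. apply mem_neg, mem_bdry; [apply fam_sing|exact Hy1].
      - apply (mem_eqv _ _ (bdry X (S n) y2 ++ e)).
        + apply mem_app; [|exact He]. apply mem_bdry; [apply fam_sing|exact Hy2].
        + clear E Ed Ey. chain_eq. }
    { destruct n as [|m]; [exact I|]. apply (mem_eqv _ _ _ _ Bc).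
      clear E Ed Ey E1. chain_eq. }
    exists (y1 ++ z), w. split; [|split; [exact Hw|]].
    - apply mem_app; [exact Hy1|]. eapply mem_mono; [|exact Hz]. apply sing_mono. tauto.
    - clear E Ed Ey E1. chain_eq. }
  assert (Surj : forall c, rcycle X n A' B' c ->
            exists d, rcycle X n A B d /\ homeq X n A' B' d c).
  { intros c Hc. apply rcycle_mem in Hc. destruct Hc as [Hc Bc].
    destruct (Hacy n c Hc) as (x & y & Hx & Hy & E).
    { eapply bmem_mono; [|exact Bc]. tauto. }
    destruct (mem_or _ _ _ _ Hy) as (y1 & y2 & Hy1 & Hy2 & Ey).
    (* The boundary of [y1] is so far only known to lie in A ∩ B'; subtracting [z] moves it into
       [B]. *)
    assert (Hz : exists z, mem (sing (fun x => A x /\ B' x)) n z /\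
                           bmem (sing B) n (y1 ++ negc X z)).
    { destruct n as [|m]; [exists []; split; [apply mem_nil|exact I]|].
      destruct (Hacy' m (bdry X (S m) y1)) as (z & w & Hz & Hw & Ez).
      - apply Inter; [apply mem_bdry; [apply fam_sing|exact Hy1]|].
        apply (mem_eqv _ _ (bdry X (S m) c ++ negc X (bdry X (S m) y2))).
        + apply mem_app; [exact Bc|]. apply mem_neg, mem_bdry; [apply fam_sing|exact Hy2].
        + intros g Hg. pose proof (E _ (resp_dg m g Hg)) as E0.
          pose proof (Ey _ (resp_dg m g Hg)) as E1. ev_norm_in E0. ev_norm_in E1.
          rewrite ev_app, ev_negc, !ev_bdry. lia.
      - destruct m as [|m]; [exact I|]. eapply mem_eqv; [apply mem_nil|].
        intros g Hg. rewrite !ev_bdry, ev_bdry_bdry. reflexivity.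
      - exists z. split; [exact Hz|]. apply (mem_eqv _ _ w _ Hw).
        clear E Ey. chain_eq. }
    destruct Hz as (z & Hz & Bz). exists (y1 ++ negc X z). split.
    - apply rcycle_mem. split; [|exact Bz]. apply mem_app; [exact Hy1|]. apply mem_neg.
      eapply mem_mono; [|exact Hz]. apply sing_mono. tauto.
    - apply rbound_rb. exists (negc X x), (negc X (z ++ y2)).
      split; [apply mem_neg; exact Hx|]. split.
      + apply mem_neg, mem_app; [|exact Hy2]. eapply mem_mono; [|exact Hz].
        apply sing_mono. tauto.
      + chain_eq. }
  exists (fun c d => rcycle X n A B c /\ rcycle X n A' B' d /\ homeq X n A' B' c d).
  split; [|split; [|split; [|split]]].
  - tauto.
  - intros c Hc. exists c. split; [exact Hc|]. split; [apply Inc, Hc|apply homeq_refl].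
  - intros c Hc. destruct (Surj c Hc) as (d & Hd & E). exists d. auto.
  - intros c c' d d' (Hc & Hc' & E) (Hd & Hd' & E').
    split; [apply rcycle_app; assumption|]. split; [apply rcycle_app; assumption|].
    apply homeq_app; assumption.
  - intros c c' d d' (Hc & Hc' & E) (Hd & Hd' & E'). split.
    + intros H. apply (homeq_trans _ _ _ _ c); [apply homeq_sym, E|].
      apply (homeq_trans _ _ _ _ d); [apply Fwd, H|exact E'].
    + intros H. apply rcycle_mem in Hc, Hd. destruct Hc as [Hc Bc], Hd as [Hd Bd].
      apply rbound_rb. apply Inj.
      * apply mem_app; [exact Hc|]. apply mem_neg, Hd.
      * destruct n as [|m]; [exact I|].
        apply (mem_eqv _ _ (bdry X (S m) c ++ negc X (bdry X (S m) d))).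
        -- apply mem_app; [exact Bc|]. apply mem_neg, Bd.
        -- clear. chain_eq.
      * apply rbound_rb. apply (homeq_trans _ _ _ _ c'); [exact E|].
        apply (homeq_trans _ _ _ _ d'); [exact H|]. apply homeq_sym, E'.
Qed.

End Isomorphisms.

(** * Essential solutions and index pairs *)

Section Dynamics.
Context {X : FiniteT0Space}.
Context (V : (X -> Prop) -> Prop) (HV : multivector_field X V).

Notation vclass := (vclass X V).
Notation Pi := (Pi X V).
Notation Inv := (Inv X V).

Lemma vclass_refl x : vclass x x.
Proof.
  destruct HV as (_ & Cov & _). destruct (Cov x) as (W & VW & Wx). exists W. auto.
Qed.

Lemma vclass_sym x y : vclass x y -> vclass y x.
Proof. intros (W & VW & Wx & Wy). exists W. auto. Qed.

Lemma vclass_trans x y z : vclass x y -> vclass y z -> vclass x z.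
Proof.
  intros (W & VW & Wx & Wy) (W' & VW' & Wy' & Wz). destruct HV as (_ & _ & Dis).
  exists W. split; [exact VW|]. split; [exact Wx|].
  apply (Dis W W' y VW VW' Wy Wy'). exact Wz.
Qed.

Lemma vclass_eq x y : vclass x y -> vclass x = vclass y.
Proof.
  intros H. apply functional_extensionality. intros z. apply propositional_extensionality.
  split; intros H'; eapply vclass_trans; eauto using vclass_sym.
Qed.

Lemma Pi_vclass x y : vclass x y -> Pi x y.
Proof. intros H. left. exact H. Qed.

Lemma Pi_below x y : below y x -> Pi x y.
Proof. intros H. right. exact H. Qed.

(** Quantified over all regular classes, not only those visited, so that prefixing a point to the
    sequence preserves it. *)
Definition leaves (f : nat -> X) : Prop :=
  forall z, regular X (vclass z) -> forall m, exists s, (m <= s)%nat /\ ~ vclass z (f s).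

(** [fwd] and [bwd] are the two halves of an essential solution through [x]; both sequences start at
    [x], the second running back in time. *)
Definition fwd (A : X -> Prop) (x : X) : Prop :=
  exists f : nat -> X, f O = x /\ (forall i, A (f i)) /\ (forall i, Pi (f i) (f (S i))) /\ leaves f.

Definition bwd (A : X -> Prop) (x : X) : Prop :=
  exists f : nat -> X, f O = x /\ (forall i, A (f i)) /\ (forall i, Pi (f (S i)) (f i)) /\ leaves f.

Lemma Inv_fwd A x : Inv A x -> fwd A x.
Proof.
  intros (phi & (HA & HP) & Ess & <-). exists (fun i => phi (Z.of_nat i)).
  split; [reflexivity|]. split; [auto|]. split.
  - intros i. replace (Z.of_nat (S i)) with (Z.of_nat i + 1) by lia. apply HP.
  - intros z Hz m. destruct (classic (vclass z (phi (Z.of_nat m)))) as [C|C].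
    + rewrite (vclass_eq _ _ C) in *. destruct (Ess _ Hz) as [_ H].
      destruct (H (Z.of_nat m)) as (s & Hs & N). exists (Z.to_nat s). split; [lia|].
      rewrite Z2Nat.id by lia. exact N.
    + exists m. auto.
Qed.

Lemma Inv_bwd A x : Inv A x -> bwd A x.
Proof.
  intros (phi & (HA & HP) & Ess & <-). exists (fun i => phi (- Z.of_nat i)).
  split; [reflexivity|]. split; [auto|]. split.
  - intros i. replace (- Z.of_nat i) with (- Z.of_nat (S i) + 1) by lia. apply HP.
  - intros z Hz m. destruct (classic (vclass z (phi (- Z.of_nat m)))) as [C|C].
    + rewrite (vclass_eq _ _ C) in *. destruct (Ess _ Hz) as [H _].
      destruct (H (- Z.of_nat m)) as (s & Hs & N). exists (Z.to_nat (- s)). split; [lia|].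
      rewrite Z2Nat.id by lia. rewrite Z.opp_involutive. exact N.
    + exists m. auto.
Qed.

Lemma fwd_bwd_Inv A x : fwd A x -> bwd A x -> Inv A x.
Proof.
  intros (f & F0 & FA & FP & FL) (b & B0 & BA & BP & BL).
  exists (fun i => if 0 <=? i then f (Z.to_nat i) else b (Z.to_nat (- i))).
  split; [split|split].
  - intros i. destruct (0 <=? i); auto.
  - intros i. destruct (Z.leb_spec 0 i), (Z.leb_spec 0 (i + 1)); try lia.
    + replace (Z.to_nat (i + 1)) with (S (Z.to_nat i)) by lia. apply FP.
    + assert (i = -1) by lia. subst i. change (Pi (b 1%nat) (f O)). rewrite F0, <- B0. apply BP.
    + replace (Z.to_nat (- i)) with (S (Z.to_nat (- (i + 1)))) by lia. apply BP.
  - intros t Ht. split; intros m.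
    + destruct (BL _ Ht (S (Z.to_nat (- m)))) as (s & Hs & N). exists (- Z.of_nat s).
      split; [lia|]. destruct (Z.leb_spec 0 (- Z.of_nat s)); [lia|].
      replace (Z.to_nat (- - Z.of_nat s)) with s by lia. exact N.
    + destruct (FL _ Ht (Z.to_nat m)) as (s & Hs & N). exists (Z.of_nat s).
      split; [lia|]. destruct (Z.leb_spec 0 (Z.of_nat s)); [|lia].
      rewrite Nat2Z.id. exact N.
  - simpl. exact F0.
Qed.

Lemma leaves_cons f : leaves (fun i => f (S i)) -> leaves f.
Proof.
  intros H z Hz m. destruct (H z Hz m) as (s & Hs & N). exists (S s). split; [lia|exact N].
Qed.

Lemma fwd_step (A : X -> Prop) x y : A x -> Pi x y -> fwd A y -> fwd A x.
Proof.
  intros Ax P (f & F0 & FA & FP & FL). exists (fun i => match i with O => x | S j => f j end).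
  split; [reflexivity|]. split; [intros [|i]; auto|]. split.
  - intros [|i]; [rewrite F0; exact P|apply FP].
  - apply leaves_cons. exact FL.
Qed.

Lemma bwd_step (A : X -> Prop) x y : A y -> Pi x y -> bwd A x -> bwd A y.
Proof.
  intros Ay P (f & F0 & FA & FP & FL). exists (fun i => match i with O => y | S j => f j end).
  split; [reflexivity|]. split; [intros [|i]; auto|]. split.
  - intros [|i]; [rewrite F0; exact P|apply FP].
  - apply leaves_cons. exact FL.
Qed.

Lemma Inv_in (A : X -> Prop) x : Inv A x -> A x.
Proof. intros (phi & (HA & _) & _ & <-). apply HA. Qed.

Lemma Inv_mono (A B : X -> Prop) x : (forall y, A y -> B y) -> Inv A x -> Inv B x.
Proof.
  intros H (phi & (HA & HP) & Ess & E). exists phi. split; [split; auto|]. auto.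
Qed.

Definition compatible (A : X -> Prop) : Prop := forall x y, A x -> vclass x y -> A y.

Lemma Inv_compatible A : compatible A -> compatible (Inv A).
Proof.
  intros HA x y Hx C. pose proof (HA _ _ (Inv_in _ _ Hx) C) as Ay. apply fwd_bwd_Inv.
  - apply (fwd_step A y x Ay); [apply Pi_vclass, vclass_sym, C|apply Inv_fwd, Hx].
  - apply (bwd_step A x y Ay); [apply Pi_vclass, C|apply Inv_bwd, Hx].
Qed.

(** * Reachability and periodic solutions *)

Inductive reach (A : X -> Prop) (x : X) : X -> Prop :=
| reach_refl : A x -> reach A x x
| reach_step y z : reach A x y -> A z -> Pi y z -> reach A x z.

Lemma reach_in A x y : reach A x y -> A y.
Proof. intros [|]; assumption. Qed.

Lemma reach_trans A x y z : reach A x y -> reach A y z -> reach A x z.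
Proof. intros H H'. induction H'; [exact H|]. eapply reach_step; eassumption. Qed.

Lemma reach_bwd A x y : reach A x y -> bwd A x -> bwd A y.
Proof. intros H Hx. induction H; [exact Hx|]. eapply bwd_step; eassumption. Qed.

Lemma reach_path A x y : reach A x y -> exists (k : nat) (q : nat -> X),
  q O = x /\ q k = y /\ (forall i, (i <= k)%nat -> A (q i)) /\
  forall i, (i < k)%nat -> Pi (q i) (q (S i)).
Proof.
  intros H. induction H as [Ax|y z H (k & q & Q0 & Qk & QA & QP) Az P].
  - exists O, (fun _ => x). split; [reflexivity|]. split; [reflexivity|]. split; [auto|].
    intros i Hi. lia.
  - exists (S k), (fun i => if (i <=? k)%nat then q i else z).
    split; [exact Q0|]. split; [destruct (Nat.leb_spec (S k) k); [lia|reflexivity]|]. split.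
    + intros i Hi. destruct (Nat.leb_spec i k); auto.
    + intros i Hi. destruct (Nat.leb_spec i k), (Nat.leb_spec (S i) k); try lia.
      * apply QP. lia.
      * replace i with k by lia. rewrite Qk. exact P.
Qed.

(** The cycle through [x] and [y] is repeated periodically. It meets two classes again and again,
    hence is outside any given class at arbitrarily early and late times. *)
Lemma cycle_Inv A x y : reach A x y -> reach A y x -> ~ vclass x y -> Inv A x.
Proof.
  intros H H' N.
  destruct (reach_path _ _ _ H) as (k1 & q1 & Q0 & Qk & QA & QP).
  destruct (reach_path _ _ _ H') as (k2 & q2 & R0 & Rk & RA & RP).
  assert (k1 <> O).
  { intros ->. apply N. rewrite <- Q0, Qk. apply vclass_refl. }
  set (k := Z.of_nat (k1 + k2)).
  set (q := fun i => if (i <=? k1)%nat then q1 i else q2 (i - k1)%nat).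
  assert (qA : forall i, (i <= k1 + k2)%nat -> A (q i)).
  { intros i Hi. unfold q. destruct (Nat.leb_spec i k1); [auto|apply RA; lia]. }
  assert (qP : forall i, (i < k1 + k2)%nat -> Pi (q i) (q (S i))).
  { intros i Hi. unfold q. destruct (Nat.leb_spec i k1), (Nat.leb_spec (S i) k1); try lia.
    - apply QP. lia.
    - replace i with k1 by lia. rewrite Qk, <- R0. replace (S k1 - k1)%nat with 1%nat by lia.
      apply RP. lia.
    - replace (S i - k1)%nat with (S (i - k1)) by lia. apply RP. lia. }
  assert (q0 : q O = x) by exact Q0.
  assert (qk : q (k1 + k2)%nat = x).
  { unfold q. destruct (Nat.leb_spec (k1 + k2) k1).
    - assert (k2 = O) by lia. subst k2. rewrite Nat.add_0_r. congruence.
    - replace (k1 + k2 - k1)%nat with k2 by lia. exact Rk. }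
  assert (qy : q k1 = y).
  { unfold q. destruct (Nat.leb_spec k1 k1); [exact Qk|lia]. }
  assert (Hk : 0 < k) by (unfold k; lia).
  assert (qmod : forall i j, 0 <= j < k -> q (Z.to_nat ((i * k + j) mod k)) = q (Z.to_nat j)).
  { intros i j Hj. rewrite Z.add_comm, Z.mod_add, Z.mod_small by lia. reflexivity. }
  exists (fun i => q (Z.to_nat (i mod k))). split; [split|split].
  - intros i. pose proof (Z.mod_pos_bound i k Hk). apply qA. unfold k in *. lia.
  - intros i. pose proof (Z.mod_pos_bound i k Hk) as B.
    pose proof (qP (Z.to_nat (i mod k))) as P. lapply P; [clear P; intros P|unfold k in *; lia].
    replace (q (Z.to_nat ((i + 1) mod k))) with (q (S (Z.to_nat (i mod k)))); [exact P|].
    rewrite <- Zplus_mod_idemp_l. destruct (Z.eq_dec (i mod k + 1) k) as [E|E].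
    + rewrite E, Z.mod_same by lia. replace (S (Z.to_nat (i mod k))) with (k1 + k2)%nat
        by (unfold k in *; lia). rewrite qk. symmetry. exact q0.
    + rewrite (Z.mod_small (i mod k + 1)) by lia. f_equal. lia.
  - intros t Ht. set (z := q (Z.to_nat (t mod k))) in *.
    assert (D : exists j, 0 <= j < k /\ ~ vclass z (q (Z.to_nat j))).
    { destruct (classic (vclass z x)) as [C|C].
      (* The index [k1], where the cycle passes through [y], is below the period only if [k2] is not
         0; [k2 = 0] would give [x = y]. *)
      - exists (if (k2 =? 0)%nat then 0 else Z.of_nat k1).
        destruct (Nat.eqb_spec k2 0) as [E|E].
        + exfalso. subst k2. apply N. rewrite <- R0, Rk. apply vclass_refl.
        + split; [unfold k; lia|]. rewrite Nat2Z.id, qy. intros C'. apply N.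
          eapply vclass_trans; [apply vclass_sym|]; eassumption.
      - exists 0. split; [lia|]. change (Z.to_nat 0) with O. rewrite q0. exact C. }
    destruct D as (j & Hj & Nj). split; intros m.
    + exists ((- Z.abs m - 1) * k + j). split; [nia|]. rewrite qmod by lia. exact Nj.
    + exists (Z.abs m * k + j). split; [nia|]. rewrite qmod by lia. exact Nj.
  - rewrite Z.mod_0_l by lia. exact q0.
Qed.

Lemma critical_Inv (A : X -> Prop) x : A x -> ~ regular X (vclass x) -> Inv A x.
Proof.
  intros Ax N. exists (fun _ => x). split; [split; [auto|]|split; [|reflexivity]].
  - intros _. apply Pi_vclass, vclass_refl.
  - intros t Ht. contradiction.
Qed.

(* If [F \ F'] is saturated and carries no essential solution, then some multivector [W] in it
   has no exits inside [F \ F']; it is regular, and [F' \/ W] is again closed. *)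
Lemma acy_Inv_empty : forall (N : nat) (l : list X) (F F' : X -> Prop), (length l <= N)%nat ->
  (forall x, F x -> ~ F' x -> In x l) ->
  is_closed X F -> is_closed X F' -> (forall x, F' x -> F x) ->
  compatible (fun x => F x /\ ~ F' x) -> (forall x, ~ Inv (fun x => F x /\ ~ F' x) x) ->
  acy (sing F) (sing F').
Proof.
  induction N as [|N IH]; intros l F F' HN Hl CF CF' I HC HI.
  { apply acy_refl, sing_mono. intros x Fx. apply NNPP. intros Nx. specialize (Hl x Fx Nx).
    destruct l; [destruct Hl|simpl in HN; lia]. }
  set (D := fun x => F x /\ ~ F' x) in *.
  destruct (classic (exists x, D x)) as [Ne|Ne].
  2: { apply acy_refl, sing_mono. intros x Fx. apply NNPP. intros Nx. apply Ne.
       exists x. split; assumption. }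
  destruct (exists_terminal (reach D) D (reach_trans D) Ne) as (x & Dx & Hx).
  (* A terminal strongly connected component that met two classes would carry a periodic essential
     solution. *)
  assert (Term : forall y, reach D x y -> vclass x y).
  { intros y H. apply NNPP. intros Nv. apply (HI x).
    apply (cycle_Inv D x y); [exact H| |exact Nv]. apply Hx; [eapply reach_in|]; exact H. }
  assert (Reg : regular X (vclass x)).
  { apply NNPP. intros H. apply (HI x). apply critical_Inv; assumption. }
  set (W := vclass x) in *.
  assert (WD : forall y, W y -> D y) by (intros y; apply HC, Dx).
  set (G := fun y => cl X W y \/ F' y).
  (* Passing to the closure of a point is a step of [Pi], so a point of [cl W] that lies in [D] is
     reachable from [x], hence in [W]. Thus [cl W] leaves [W] only into [F']. *)
  assert (GW : forall y, G y <-> W y \/ F' y).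
  { intros y. split.
    - intros [H|H]; [|right; exact H]. apply cl_below in H. destruct H as (w & Ww & L).
      pose proof (WD w Ww) as [Fw _].
      destruct (classic (F' y)) as [Hy|Hy]; [right; exact Hy|left]. apply Term.
      apply (reach_step D x w); [|split; [apply (closed_below F y w); assumption|exact Hy]|].
      + apply (reach_step D x x); [apply reach_refl, Dx|apply WD, Ww|apply Pi_vclass, Ww].
      + apply Pi_below, L.
    - intros [H|H]; [left|right; exact H]. apply cl_below. exists y. split; [exact H|apply below_refl]. }
  pose proof (closed_cl W) as CW.
  assert (GF : forall y, G y -> F y).
  { intros y Gy. apply GW in Gy. destruct Gy as [H|H]; [apply WD in H; apply H|apply I, H]. }
  assert (CG : is_closed X G).
  { apply downset_closed. intros u v L [H|H]; [left|right]; eapply closed_below; eassumption. }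
  destruct (in_split _ _ (Hl x (proj1 Dx) (proj2 Dx))) as (l1 & l2 & El).
  apply (acy_trans _ (sing G)).
  - apply sing_mono, GF.
  - apply sing_mono. intros y Hy. right. exact Hy.
  - apply (IH (l1 ++ l2)).
    + rewrite El, length_app in HN. rewrite length_app. simpl in HN. lia.
    + intros y Fy NG. assert (NF : ~ F' y) by (intros H; apply NG; right; exact H).
      specialize (Hl y Fy NF). rewrite El in Hl. apply in_app_or in Hl. apply in_or_app.
      destruct Hl as [Hl|[Hl|Hl]]; auto. subst y. exfalso. apply NG, GW. left. apply vclass_refl.
    + exact CF.
    + exact CG.
    + exact GF.
    + intros y z [Fy Ny] C. assert (Dy : D y) by (split; [exact Fy|intros H; apply Ny; right; exact H]).
      pose proof (HC y z Dy C) as [Fz Nz]. split; [exact Fz|]. intros Gz. apply GW in Gz.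
      destruct Gz as [Wz|Hz]; [|contradiction]. apply Ny, GW. left.
      eapply vclass_trans; [exact Wz|apply vclass_sym, C].
    + intros y Hy. apply (HI y). revert Hy. apply Inv_mono. intros z [Fz Nz].
      split; [exact Fz|]. intros H. apply Nz. right. exact H.
  - apply (acy_trans _ (fun n s => sing (cl X W) n s \/ sing F' n s)).
    + intros n s [H|H]; revert H; apply sing_mono; intros y Hy; [left|right]; exact Hy.
    + intros n s H. right. exact H.
    + apply acy_closed_union; assumption.
    (* The set [cl W] meets [F'] exactly in [mo W], and regularity of [W] is the vanishing for this
       pair. *)
    + apply (acy_excision _ (sing (cl X W)) _ (sing (mo X W))).
      * apply fam_sing.
      * apply fam_sing.
      * tauto.
      * tauto.
      * intros n s H H'. pose proof (sing_inter _ _ _ _ H H') as J. revert J. apply sing_mono.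
        intros y [Hy Hy']. split; [exact Hy|]. intros Wy. apply (WD y Wy), Hy'.
      * apply sing_mono. intros y [Hy Ny]. assert (Gy : G y) by (left; exact Hy).
        apply GW in Gy. tauto.
      * apply acy_H_trivial, Reg.
Qed.

(* With [A = P1 \ P2] and [A'] the part of [A] reachable from [S] in [A], both [P1 \ (P2 \/ A')]
   and [A' \ S] are saturated and disjoint from [S = Inv A].  Hence the pairs [(P1, P2)] and
   [(cl S, mo S)] are both compared with [(P1, K)], [K = P2 \/ (A' \ S)]. *)
Lemma index_pair_iso (S P1 P2 : X -> Prop) : index_pair X V S P1 P2 ->
  forall n, rel_iso n P1 P2 (cl X S) (mo X S).
Proof.
  intros (C1 & C2 & I21 & IP1 & IP2 & IP3) n.
  destruct (finite_pts X) as [l Hl].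
  set (A := fun x => P1 x /\ ~ P2 x) in *.
  (* Condition (IP2) forbids a class that meets [A] to leave [P1]; (IP1), applied from the other
     point of the class, forbids it to meet [P2]. *)
  assert (HA : compatible A).
  { intros x y [H1 H2] C. assert (H1y : P1 y).
    { apply NNPP. intros Ny. apply H2, (IP2 x H1). exists y. split; [apply Pi_vclass, C|exact Ny]. }
    split; [exact H1y|]. intros H2y. apply H2, (IP1 y x H2y); [|exact H1].
    apply Pi_vclass, vclass_sym, C. }
  assert (SA : forall x, S x -> A x) by (intros x Hx; apply Inv_in, IP3, Hx).
  assert (HS : compatible S).
  { intros x y Hx C. apply IP3. apply (Inv_compatible A HA x); [apply IP3, Hx|exact C]. }
  set (A' := fun y => exists x, S x /\ reach A x y).
  assert (A'A : forall x, A' x -> A x) by (intros x (y & _ & H); eapply reach_in, H).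
  assert (SA' : forall x, S x -> A' x) by (intros x Hx; exists x; split; [|apply reach_refl]; auto).
  assert (A'step : forall x y, A' x -> A y -> Pi x y -> A' y).
  { intros x y (z & Hz & R) Ay P. exists z. split; [exact Hz|]. eapply reach_step; eassumption. }
  (* Such an [x] has a past through [S] and a future into [S], hence lies in [Inv A]. This convexity
     of [S] is what makes [K] closed. *)
  assert (Between : forall x y, A' x -> S y -> Pi x y -> S x).
  { intros x y A'x Sy P. apply IP3. apply fwd_bwd_Inv.
    - apply (fwd_step A x y (A'A x A'x) P). apply Inv_fwd, IP3, Sy.
    - destruct A'x as (z & Sz & R). apply (reach_bwd A z x R). apply Inv_bwd, IP3, Sz. }
  set (M := fun x => P2 x \/ A' x).
  set (K := fun x => P2 x \/ (A' x /\ ~ S x)).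
  assert (M1 : forall x, M x -> P1 x) by (intros x [H|H]; [apply I21, H|apply (A'A x H)]).
  assert (KM : forall x, K x -> M x) by (intros x [H|H]; [left|right]; tauto).
  assert (CM : is_closed X M).
  { apply downset_closed. intros x y L My. pose proof (closed_below P1 x y C1 (M1 y My) L) as H1.
    destruct (classic (P2 x)) as [H2|H2]; [left; exact H2|right].
    destruct My as [H|H]; [exfalso; apply H2; eapply closed_below; eassumption|].
    apply (A'step y x H); [split; assumption|apply Pi_below, L]. }
  assert (CK : is_closed X K).
  { apply downset_closed. intros x y L Ky.
    destruct (closed_below M x y CM (KM y Ky) L) as [H|H]; [left; exact H|].
    destruct Ky as [H'|[H' NS]]; [left; eapply closed_below; eassumption|].
    right. split; [exact H|]. intros Sx. apply NS. apply (Between y x H' Sx), Pi_below, L. }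
  assert (clS_M : forall x, cl X S x -> M x).
  { intros x Hx. apply (Hx M CM). intros y Sy. right. apply SA', Sy. }
  assert (MKS : forall x, M x -> ~ S x -> K x).
  { intros x [H|H] NS; [left; exact H|right; auto]. }
  assert (KS : forall x, K x -> ~ S x) by (intros x [H|[_ H]] Sx; [apply (SA x Sx), H|exact (H Sx)]).
  assert (clS : forall x, S x -> cl X S x) by (intros x Sx C _ HC; apply HC, Sx).
  pose proof (closed_cl S) as CclS.
  assert (E1 : acy (sing P1) (sing M)).
  { apply (acy_Inv_empty (length l) l); auto.
    - intros x y [H1 NM] C. assert (Ax : A x) by (split; [exact H1|intros H; apply NM; left; exact H]).
      pose proof (HA x y Ax C) as Ay. split; [apply Ay|]. intros [H|H]; [apply Ay, H|].
      apply NM. right. apply (A'step y x H Ax), Pi_vclass, vclass_sym, C.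
    - intros x Hx. apply (Inv_in _ _ Hx). right. apply SA', IP3. revert Hx. apply Inv_mono.
      intros y [H1 NM]. split; [exact H1|]. intros H. apply NM. left. exact H. }
  assert (E2 : acy (sing K) (sing P2)).
  { apply (acy_Inv_empty (length l) l); auto.
    - intros x H. left. exact H.
    - intros x y [[H|[A'x NS]] N2] C; [contradiction|].
      pose proof (HA x y (A'A x A'x) C) as Ay. split; [right; split|apply Ay].
      + apply (A'step x y A'x Ay), Pi_vclass, C.
      + intros Sy. apply NS. apply (HS y x Sy), vclass_sym, C.
    - intros x Hx. destruct (Inv_in _ _ Hx) as [Kx _]. apply (KS x Kx), IP3. revert Hx.
      apply Inv_mono. intros y [Ky N2]. split; [apply M1, KM, Ky|exact N2]. }
  (* Enlarging [P2] to [K] is harmless by [E2]. By [E1], [P1] may be replaced by [M], the union of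
     [cl S] and [K], and [cl S] meets [K] in [mo S]. *)
  apply (rel_iso_trans _ _ _ P1 K).
  - apply rel_iso_inclusion; auto.
    + intros x H. left. exact H.
    + apply acy_refl. auto.
    + apply (acy_iff (sing K) (sing P2)); [|tauto|exact E2].
      intros k s. split; apply sing_mono; [|tauto]. intros x Kx. split; [|exact Kx]. auto.
  - apply rel_iso_sym, rel_iso_inclusion; auto.
    + intros x [H _]. exact H.
    + intros x [H NS]. auto.
    + apply (acy_trans _ (sing M)); [apply sing_mono, M1| |exact E1|].
      * intros k s [H|H]; revert H; apply sing_mono; auto.
      * apply (acy_iff (sing (fun x => cl X S x \/ K x)) (fun k s => sing (cl X S) k s \/ sing K k s));
          [|tauto|apply acy_closed_union; assumption].
        intros k s. split; apply sing_mono.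
        -- intros x [H|H]; auto.
        -- intros x Mx. destruct (classic (S x)); auto.
    + apply acy_refl, sing_mono. intros x [H Kx]. split; [exact H|]. apply KS, Kx.
Qed.

End Dynamics.

Theorem theorem5p18 (X : FiniteT0Space) (V : (X -> Prop) -> Prop)
  (S P1 P2 Q1 Q2 : X -> Prop) :
  multivector_field X V ->
  isolated_invariant X V S ->
  index_pair X V S P1 P2 ->
  index_pair X V S Q1 Q2 ->
  H_isomorphic X P1 P2 Q1 Q2.
Proof.
  intros HV _ HP HQ n. apply rel_iso_H_iso.
  apply (rel_iso_trans _ _ _ (cl X S) (mo X S)).
  - apply (index_pair_iso V HV), HP.
  - apply rel_iso_sym, (index_pair_iso V HV), HQ.
Qed.
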